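(* Let $m\ge1$ be an integer, let $u\in H_0^m(\Omega)$ be the solution of the $2m$-th order Dirichlet problem $a(u,v)=(f,v)$ for all $v\in H_0^m(\Omega)$, and let $u_h\in V_h$ be its finite element approximation, i.e. $a_h(u_h,v_h)=(f,v_h)$ for all $v_h\in V_h$. Assume that the upper bound of the discretization error $\|u-u_h\|_{m,h}\le Ch^{s-m}\|u\|_{s}$, $0<s\le r$, holds. Assume there exist a subdomain $G\subset\subset\Omega$ such that $u\in W^{r+\delta,p}(G)$ $(\delta>0)$ and a multi-index $\gamma$ with $|\gamma|=r$ such that $\|D^\gamma u\|_{0,p,G}>0$ and $D^\gamma v_h=0$ for any $v_h\in V_h$. If the family $\{\mathcal{T}_h\}$ of partitions is regular, the finite element solution $u_h$ has the following lower bounds of the discretization error: $$\Big(\sum_{K\in\mathcal{T}_h^G}h_K^{p(j-r)}\|u-u_h\|_{j,p,K}^p\Big)^{1/p}\ \ge\ C_{17},\qquad 0\le j\le r,$$ and $$\Big(\sum_{K\in\mathcal{T}_h^G}h_K^{p\left((j-r)+n\left(\frac1p-\frac1q\right)\right)}\|u-u_h\|_{j,q,K}^p\Big)^{1/p}\ \ge\ C_{18},\qquad 0\le j\le r,$$ where $1\le p<\infty$, $1\le q\le\infty$ (such that $W^{r+\delta,p}(G)$ can be imbedded into $W^{j,q}(G)$), and $C_{17}$ and $C_{18}$ are positive constants independent of the mesh size $h_G$, but dependent on $u$.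
   Context: $\Omega\subset\mathbb{R}^n$ ($n\ge1$) is a bounded polytopic domain with Lipschitz continuous boundary. $W^{s,p}(G)$ denotes the usual Sobolev space with norm $\|\cdot\|_{s,p,G}$; the index $p$ is omitted when $p=2$ and the index $G$ is omitted when $G=\Omega$. $D^\alpha$ is the partial derivative of multi-index $\alpha$ and $|\alpha|=\sum_i\alpha_i$. $G\subset\subset\Omega$ means $G\subset\Omega$, $\mathrm{dist}(\partial\Omega,G)>0$ and $\mathrm{meas}(G)>0$. $(\cdot,\cdot)$ is the $L^2(\Omega)$ inner product; $f$ is a given right-hand side. The strong form of the problem is $(-1)^m\Delta^m u=f$ in $\Omega$, $\partial^j u/\partial\nu^j=0$ on $\partial\Omega$ for $0\le j\le m-1$ ($\nu$ the unit outer normal), and $a(u,v)=\int_\Omega\sum_{|\alpha|=m}D^\alpha u\,D^\alpha v\,d\Omega$. $\mathcal{T}_h$ is a face-to-face partition of $\Omega$ into elements $K$ (triangles, rectangles, tetrahedra, bricks, etc.), so $\bar\Omega=\bigcup_{K\in\mathcal{T}_h}K$; $h_K=\mathrm{diam}\,K$ and $h=\max_{K\in\mathcal{T}_h}h_K$. $\mathcal{T}_h^G=\{K\in\mathcal{T}_h: K\subset G\}$ and $h_G=\max_{K\in\mathcal{T}_h^G}h_K$. A family $\{\mathcal{T}_h\}$ is regular if there is $\sigma>0$ with $h_K/\tau_K<\sigma$ for all $K\in\mathcal{T}_h$, where $\tau_K$ is the maximum diameter of an inscribed ball in $K$. $V_h$ is a suitable finite element space (conforming or nonconforming for the $2m$-th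 order elliptic problem) of piecewise polynomials of degree less than $r$ ($r\ge1$ an integer) on $\mathcal{T}_h$; derivatives of $v_h\in V_h$ are taken element by element, and $a_h(u_h,v_h)=\sum_{K\in\mathcal{T}_h}\int_K\sum_{|\alpha|=m}D^\alpha u_h\,D^\alpha v_h\,dK$. $\|\cdot\|_{j,q,K}$ is the $W^{j,q}(K)$ norm, and $\|v\|_{m,h}=\big(\sum_{K\in\mathcal{T}_h}\|v\|_{m,2,K}^2\big)^{1/2}$.
   Formalization: The lower bounds are claimed only for partitions with mesh size h below a threshold h_0 > 0 independent of the partition; for coarse partitions no element need lie in G, so the sums can be empty and the bounds fail. *)

(* Defs.v *)
From HB Require Import structures.
From mathcomp Require Import all_boot all_order all_algebra.
From mathcomp Require Import all_classical all_reals all_analysis.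

Set Implicit Arguments.
Unset Strict Implicit.
Unset Printing Implicit Defensive.

Import Order.TTheory GRing.Theory Num.Theory.
Import numFieldNormedType.Exports.

Local Open Scope classical_set_scope.
Local Open Scope ring_scope.

(* The sigma-algebra on row vectors is generated by the coordinates. *)
Section measurable_rV.
Context (R : realType) (n : nat).

Definition rV_coord (i : 'I_n) (x : 'rV[R]_n) : R := x ord0 i.

Let rV_set0 : g_sigma_preimage rV_coord set0.
Proof. exact: sigma_algebra0. Qed.

Let rV_setC A : g_sigma_preimage rV_coord A -> g_sigma_preimage rV_coord (~` A).
Proof. exact: sigma_algebraC. Qed.

Let rV_bigcup (F : (set 'rV[R]_n)^nat) :
  (forall i, g_sigma_preimage rV_coord (F i)) ->
  g_sigma_preimage rV_coord (\bigcup_i (F i)).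
Proof. exact: sigma_algebra_bigcup. Qed.

HB.instance Definition _ := @isMeasurable.Build default_measure_display
  'rV[R]_n (g_sigma_preimage rV_coord) rV_set0 rV_setC rV_bigcup.

Lemma measurable_rV_coord (i : 'I_n) : measurable_fun [set: 'rV[R]_n] (rV_coord i).
Proof.
move=> _ Y mY; rewrite setTI; apply: sub_sigma_algebra => /=.
rewrite -bigcup_seq/=; exists i => /=; first by rewrite mem_index_enum.
by exists Y => //; rewrite setTI.
Qed.

Lemma measurable_fun_rVP d (T : measurableType d) (f : T -> 'rV[R]_n) :
  (forall i, measurable_fun [set: T] (rV_coord i \o f)) ->
  measurable_fun [set: T] f.
Proof.
move=> mf _ A mA.
have : preimage_set_system [set: T] f (g_sigma_preimage rV_coord)
    ([set: T] `&` f @^-1` A) by exists A.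
rewrite -g_sigma_preimageE; apply: smallest_sub.
  exact: sigma_algebra_measurable.
move=> _ [B + <-]; rewrite -bigcup_seq => -[i _ [C mC <-]].
by rewrite !setTI; have := mf i measurableT C mC; rewrite setTI.
Qed.

End measurable_rV.

Section lebesgue_rV_step.
Context (R : realType) (n : nat).

Definition rV_cons (x : measurableTypeR R * 'rV[R]_n) : 'rV[R]_n.+1 :=
  \row_(i < n.+1) if unlift ord0 i is Some j then x.2 ord0 j else x.1.

Definition rV_uncons (x : 'rV[R]_n.+1) : measurableTypeR R * 'rV[R]_n :=
  (x ord0 ord0, \row_(j < n) x ord0 (lift ord0 j)).

Lemma rV_consK : cancel rV_cons rV_uncons.
Proof.
move=> [a x]; rewrite /rV_uncons mxE unlift_none; congr (_, _).
by apply/rowP => j; rewrite !mxE liftK.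
Qed.

Lemma rV_unconsK : cancel rV_uncons rV_cons.
Proof.
move=> x; apply/rowP => i; rewrite mxE.
by case: unliftP => [j|] -> //=; rewrite mxE.
Qed.

Lemma measurable_rV_cons : measurable_fun [set: _] rV_cons.
Proof.
apply: measurable_fun_rVP => i.
case: (unliftP ord0 i) => [j ->|->].
- rewrite (_ : _ \o _ = rV_coord j \o snd); last first.
    by apply/funext => x; rewrite /rV_coord /= mxE liftK.
  exact: measurableT_comp (measurable_rV_coord j) measurable_snd.
- rewrite (_ : _ \o _ = fst); first exact: measurable_fst.
  by apply/funext => x; rewrite /rV_coord /= mxE unlift_none.
Qed.

Lemma measurable_rV_uncons : measurable_fun [set: _] rV_uncons.
Proof.
apply/measurable_fun_pairP; split.
  exact: (measurable_rV_coord ord0).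
apply: measurable_fun_rVP => i.
rewrite (_ : _ \o _ = rV_coord (lift ord0 i)); first exact: measurable_rV_coord.
by apply/funext => x; rewrite /rV_coord /= mxE.
Qed.

Variable mu : {sigma_finite_measure set 'rV[R]_n -> \bar R}.

Definition lebesgue_rV_cons : set 'rV[R]_n.+1 -> \bar R :=
  pushforward ((@lebesgue_measure R) \x mu)%E rV_cons.

Let mpre A : measurable A -> measurable (rV_cons @^-1` A).
Proof.
by move=> mA; rewrite -[X in measurable X]setTI; exact: measurable_rV_cons.
Qed.

Let lebesgue_rV_cons0 : lebesgue_rV_cons set0 = 0%E.
Proof. by rewrite /lebesgue_rV_cons /pushforward preimage_set0 measure0. Qed.

Let lebesgue_rV_cons_ge0 A : (0 <= lebesgue_rV_cons A)%E.
Proof. by rewrite /lebesgue_rV_cons /pushforward measure_ge0. Qed.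

Let lebesgue_rV_cons_sigma_additive : semi_sigma_additive lebesgue_rV_cons.
Proof.
move=> F mF tF mUF; rewrite /lebesgue_rV_cons /pushforward preimage_bigcup.
apply: measure_semi_sigma_additive.
- by move=> k; exact: mpre.
- apply/trivIsetP => /= i j _ _ ij; rewrite -preimage_setI.
  by move/trivIsetP : tF => /(_ _ _ _ _ ij) ->//; rewrite preimage_set0.
- by rewrite -preimage_bigcup; exact: mpre.
Qed.

HB.instance Definition _ := isMeasure.Build _ _ _ lebesgue_rV_cons
  lebesgue_rV_cons0 lebesgue_rV_cons_ge0 lebesgue_rV_cons_sigma_additive.

Let lebesgue_rV_cons_sigma_finite : sigma_finite setT lebesgue_rV_cons.
Proof.
have /sigma_finiteP[F [FT ndF Foo]] := sigma_finiteT (@lebesgue_measure R).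
have /sigma_finiteP[H [HT ndH Hoo]] := sigma_finiteT mu.
exists (fun k => rV_uncons @^-1` (F k `*` H k)).
  rewrite -preimage_bigcup -(preimage_setT rV_uncons); congr (_ @^-1` _).
  apply/esym; rewrite -subTset => -[x y] _.
  have [i _ Fx] : (\bigcup_i F i) x by rewrite -FT.
  have [j _ Hy] : (\bigcup_j H j) y by rewrite -HT.
  exists (maxn i j) => //; split.
  - by move: Fx; exact/subsetPset/ndF/leq_maxl.
  - by move: Hy; exact/subsetPset/ndH/leq_maxr.
move=> k; have [mF ?] := Foo k; have [mH ?] := Hoo k; split.
  rewrite -[X in measurable X]setTI; apply: measurable_rV_uncons => //.
  exact: measurableX.
rewrite /lebesgue_rV_cons /pushforward.
rewrite (_ : rV_cons @^-1` _ = F k `*` H k); last first.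
  by apply/seteqP; split => x; rewrite /preimage /mkset rV_consK.
by rewrite product_measure1E// lte_mul_pinfty// ge0_fin_numE.
Qed.

HB.instance Definition _ := Measure_isSigmaFinite.Build _ _ _ lebesgue_rV_cons
  lebesgue_rV_cons_sigma_finite.

End lebesgue_rV_step.

(* n-dimensional Lebesgue measure, as an iterated product measure. *)
Fixpoint lebesgue_rV (R : realType) (n : nat) :
    {sigma_finite_measure set 'rV[R]_n -> \bar R} :=
  match n with
  | 0 => \d_(0 : 'rV[R]_0)
  | k.+1 => lebesgue_rV_cons (lebesgue_rV R k)
  end.

Section euclidean.
Context (R : realType) (n : nat).
Implicit Types (x y a : 'rV[R]_n) (A K G : set 'rV[R]_n).

Definition dotv x y : R := \sum_(i < n) x ord0 i * y ord0 i.

(* The norm of the library on ['rV[R]_n] is the max norm. *)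
Definition enorm x : R := Num.sqrt (dotv x x).

Definition bdry A : set 'rV[R]_n := closure A `\` A°.

Definition domain A := [/\ A !=set0, open A & connected A].

Definition diam A : R := sup [set enorm (x - y) | x in A & y in A].

Definition inball_diam A : R :=
  sup [set 2 * rho | rho in
    [set rho : R | 0 <= rho /\
       exists x, [set y | enorm (y - x) <= rho] `<=` A]].

Definition dist A B : R := inf [set enorm (x - y) | x in A & y in B].

Definition compactly_contained G A :=
  [/\ G `<=` A, 0 < dist (bdry A) G & (0 < lebesgue_rV R n G)%E].

Definition polytope K := exists (N : nat) (v : 'I_N -> 'rV[R]_n),
  K = [set x | exists c : 'I_N -> R, [/\ forall i, 0 <= c i,
        \sum_(i < N) c i = 1 & x = \sum_(i < N) c i *: v i]].

Definition face F K := exists (a : 'rV[R]_n) (b : R),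
  (forall x, K x -> dotv a x <= b) /\ F = K `&` [set x | dotv a x = b].

Definition polytopic A := exists (N : nat) (P : 'I_N -> set 'rV[R]_n),
  (forall i, polytope (P i)) /\ closure A = \bigcup_i P i.

(* Near each boundary point x0, A is the strict epigraph, in the direction of a
   unit vector e, of a Lipschitz function of the component orthogonal to e. *)
Definition lipschitz_boundary A := forall x0, bdry A x0 ->
  exists (e : 'rV[R]_n) (rho L : R) (phi : 'rV[R]_n -> R),
    [/\ enorm e = 1, 0 < rho,
        (forall y z, `|phi y - phi z| <= L * enorm (y - z)) &
        forall y, enorm (y - x0) < rho ->
          (A y <-> phi (y - x0 - dotv (y - x0) e *: e) < dotv (y - x0) e)].

End euclidean.

Section sobolev.
Context (R : realType) (n : nat).
Implicit Types (G : set 'rV[R]_n) (w g phi : 'rV[R]_n -> R).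
Implicit Types (alpha : 'I_n -> nat).

Definition mlen alpha : nat := (\sum_(i < n) alpha i)%N.

(* A finite type containing every multi-index of length at most k. *)
Definition midx (k : nat) := {ffun 'I_n -> 'I_k.+1}.
Definition mval (k : nat) (alpha : midx k) : 'I_n -> nat := fun i => alpha i.

Definition partial (i : 'I_n) w : 'rV[R]_n -> R := fun x => 'D_(delta_mx 0 i) w x.

Definition pderiv alpha w : 'rV[R]_n -> R :=
  foldr (fun i h => iter (alpha i) (partial i) h) w (enum 'I_n).

Definition smooth phi := forall (s : seq 'I_n) (i : 'I_n) (x : 'rV[R]_n),
  {for x, continuous (foldr partial phi s)} /\
  derivable (foldr partial phi s) x (delta_mx 0 i).

Definition test_function G phi := smooth phi /\
  exists K, [/\ compact K, K `<=` G & forall x, ~ K x -> phi x = 0].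

Definition loc_integrable G w := measurable_fun G w /\
  forall K, compact K -> K `<=` G ->
    (lebesgue_rV R n).-integrable K (EFin \o w).

Definition is_weak_deriv G alpha w g :=
  [/\ loc_integrable G w, loc_integrable G g &
      forall phi, test_function G phi ->
        \int[lebesgue_rV R n]_(x in G) (w x * pderiv alpha phi x) =
        (-1) ^+ mlen alpha * \int[lebesgue_rV R n]_(x in G) (g x * phi x)].

(* A representative of the weak derivative, when there is one. *)
Definition wderiv G alpha w : 'rV[R]_n -> R :=
  xget (cst 0) [set g | is_weak_deriv G alpha w g].

Definition Lp_norm G (q : \bar R) w : \bar R :=
  Lnorm (lebesgue_rV R n) q (fun x => (\1_G x * w x)%:E).

(* The norm of W^{k,q}(G) for q real or +oo, with value +oo when a weak
   derivative of order at most k does not exist: W^{k,q}(G) is the set of the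
   functions of finite norm. *)
Definition sobolev_norm (k : nat) (q : \bar R) G w : \bar R :=
  if `[< forall alpha, (mlen alpha <= k)%N -> exists g, is_weak_deriv G alpha w g >]
  then match q with
       | q'%:E => (\sum_(alpha : midx k | (mlen (mval alpha) <= k)%N)
                     Lp_norm G q (wderiv G (mval alpha) w) `^ q') `^ q'^-1
       | _ => \big[maxe/0]_(alpha : midx k | (mlen (mval alpha) <= k)%N)
                Lp_norm G q (wderiv G (mval alpha) w)
       end%E
  else +oo%E.

Definition slobodeckij (k : nat) (theta p : R) G w : \bar R :=
  (\sum_(alpha : midx k | mlen (mval alpha) == k)
     \int[lebesgue_rV R n]_(x in G) \int[lebesgue_rV R n]_(y in G)
       (`|wderiv G (mval alpha) w x - wderiv G (mval alpha) w y| `^ p /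
        enorm (x - y) `^ (n%:R + theta * p))%:E)%E.

(* The norm of W^{s,p}(G) for real s >= 0 (Sobolev-Slobodeckij). *)
Definition frac_norm (s p : R) G w : \bar R :=
  let k := Num.truncn s in
  let theta := s - k%:R in
  ((sobolev_norm k p%:E G w `^ p +
    (if (theta == 0)%R then 0 else slobodeckij k theta p G w)) `^ p^-1)%E.

Definition H0 (m : nat) G w := (sobolev_norm m 2%:E G w < +oo)%E /\
  forall eps : R, 0 < eps -> exists phi, test_function G phi /\
    (sobolev_norm m 2%:E G (fun x => w x - phi x)%R < eps%:E)%E.

Definition embeds (s p : R) (j : nat) (q : \bar R) G := exists c : R, 0 < c /\
  forall w, (frac_norm s p G w < +oo)%E ->
    (sobolev_norm j q G w <= c%:E * frac_norm s p G w)%E.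

Definition L2_fun G w := measurable_fun G w /\ (Lp_norm G 2%:E w < +oo)%E.

Definition L2_dot G w g : R := \int[lebesgue_rV R n]_(x in G) (w x * g x).

Definition a_form (m : nat) G w g : R :=
  \int[lebesgue_rV R n]_(x in G)
    \sum_(alpha : midx m | mlen (mval alpha) == m)
      wderiv G (mval alpha) w x * wderiv G (mval alpha) g x.

End sobolev.

Section finite_elements.
Context (R : realType) (n : nat).

Record mesh := Mesh { nelt : nat ; elt : 'I_nelt -> set 'rV[R]_n }.
Arguments elt : clear implicits.

Definition partition_of (Omega : set 'rV[R]_n) (T : mesh) :=
  [/\ forall k, polytope (elt T k) /\ (elt T k)° !=set0,
      closure Omega = \bigcup_k elt T k,
      forall k l, k != l -> (elt T k)° `&` (elt T l)° = set0 &
      forall k l, face (elt T k `&` elt T l) (elt T k)].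

Definition mesh_size (T : mesh) : R := \big[Num.max/0]_(k < nelt T) diam (elt T k).

Definition regular_family (I : Type) (T : I -> mesh) := exists sigma : R,
  0 < sigma /\ forall i k, diam (elt (T i) k) / inball_diam (elt (T i) k) < sigma.

(* Polynomial functions of degree less than r in each variable; they include
   those of total degree less than r. *)
Definition poly_fun (r : nat) (P : 'rV[R]_n -> R) :=
  exists c : {ffun 'I_n -> 'I_r} -> R, forall x,
    P x = \sum_alpha c alpha * \prod_(i < n) x ord0 i ^+ alpha i.

(* A piecewise function assigns to each element a function of its own, hence
   may be two-valued on interelement boundaries; the interior of an element
   carries its integrals and Sobolev norms. *)
Definition pw_fun (T : mesh) := 'I_(nelt T) -> 'rV[R]_n -> R.

Definition fe_space (r : nat) (T : mesh) (V : set (pw_fun T)) :=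
  [/\ forall v, V v -> forall k, poly_fun r (v k),
      V (fun _ _ => 0) &
      forall (c : R) v w, V v -> V w -> V (fun k x => c * v k x + w k x)].

Definition ah_form (m : nat) (T : mesh) (v w : pw_fun T) : R :=
  \sum_(k < nelt T) \int[lebesgue_rV R n]_(x in (elt T k)°)
    \sum_(alpha : midx n m | mlen (mval alpha) == m)
      pderiv (mval alpha) (v k) x * pderiv (mval alpha) (w k) x.

Definition L2_dot_h (T : mesh) (f : 'rV[R]_n -> R) (v : pw_fun T) : R :=
  \sum_(k < nelt T) L2_dot (elt T k)° f (v k).

Definition err (T : mesh) (u : 'rV[R]_n -> R) (v : pw_fun T) : pw_fun T :=
  fun k x => u x - v k x.

Definition norm_mh (m : nat) (T : mesh) (v : pw_fun T) : \bar R :=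
  ((\sum_(k < nelt T) sobolev_norm m 2%:E (elt T k)° (v k) `^ 2) `^ 2^-1)%E.

(* (sum over K in T^G of h_K^(p beta) |v|_{j,q,K}^p)^(1/p), where T^G is the set
   of the elements included in G. *)
Definition weighted_norm (p beta : R) (j : nat) (q : \bar R) (T : mesh)
    (G : set 'rV[R]_n) (v : pw_fun T) : \bar R :=
  ((\sum_(k < nelt T | `[< elt T k `<=` G >])
      (diam (elt T k) `^ (p * beta))%R%:E *
      sobolev_norm j q (elt T k)° (v k) `^ p) `^ p^-1)%E.

End finite_elements.

Arguments elt {R n} T k : rename.

(* Main.v *)
Require Import Defs.
From HB Require Import structures.
From mathcomp Require Import all_boot all_order all_algebra.
From mathcomp Require Import all_classical all_reals all_analysis.
From mathcomp Require Import measurable_realfun ess_sup_inf.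
From mathcomp Require Import ring lra.

Set Implicit Arguments.
Unset Strict Implicit.
Unset Printing Implicit Defensive.

Import Order.TTheory GRing.Theory Num.Theory.
Import numFieldNormedType.Exports.

Local Open Scope classical_set_scope.
Local Open Scope ring_scope.

(** On an element [K] inside [G], of diameter [h], take a smooth bump [phi]
    supported in a cube of half-side [kappa h] inside [K]; such a cube exists by
    shape regularity. As [D^gamma u_h = 0] on [K], integrating by parts gives
    [int (D^gamma u) phi = +- int D^beta (u - u_h) D^(gamma - beta) phi] for any
    [beta <= gamma] of length [j], so by Hoelder's inequality the weighted
    [W^{j,q}(K)] norm of the error dominates the scaled average
    [|int_K (D^gamma u) phi| / h^n]. Since [D^gamma u] is not almost everywhere
    zero, there is a cube inside [G] on which it is close in mean to a constant
    [a <> 0]; summed over the elements inside this cube, the averages weighted by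
    [h^n] are at least a fixed multiple of [|a|]. *)

(** * Smooth functions of one variable *)

Section smooth_real_functions.
Context {R : realType}.
Implicit Types (f g : R -> R) (P : {poly R}).

(** Cubes and tensor-product bumps are used because polynomials are sums of products too: every
    integral then factors over the coordinates, and integration by parts is only needed in one
    variable. The bumps fill only a fixed fraction of the elements, about [kappa ^+ n], and their
    positions vary with the mesh. Oscillations of [D^gamma u] could therefore make all the averages
    small. This is why the cube of almost constancy is chosen once, before the mesh, with a relative
    tolerance depending only on [kappa] and [n]: the deviation from [a] is then at most half of what
    the constant [a] contributes. The mesh only has to be fine compared with that cube, whence the
    threshold [h0]. *)

Definition smooth1 f := forall k x, derivable (derive1n k f) x 1.

(** Coinduction principle: a set of functions stable under derivation contains only smooth
    functions. Each smoothness proof below amounts to exhibiting such a set, which avoids closed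
    formulas for higher derivatives. *)
Lemma smooth1_coind (S : set (R -> R)) :
  (forall f, S f -> exists2 g, S g & forall x : R, is_derive x 1 f (g x)) ->
  forall f, S f -> smooth1 f.
Proof.
move=> H f Sf k; suff : S (derive1n k f).
  by move=> Sk x; have [h _ /(_ x)[]] := H _ Sk.
elim: k => [//|k IH]; rewrite derive1nS.
have [g Sg dg] := H _ IH; suff -> : derive1 (derive1n k f) = g by [].
by apply/funext => x; rewrite derive1E; have [_ ->] := dg x.
Qed.

Lemma smooth1_is_derive f k (x : R) : smooth1 f ->
  is_derive x 1 (derive1n k f) (derive1n k.+1 f x).
Proof. by move=> sf; rewrite derive1nS derive1E; apply: DeriveDef. Qed.

Lemma smooth1_derive1n f k : smooth1 f -> smooth1 (derive1n k f).
Proof. by move=> sf l x; rewrite /derive1n -iterD; exact: sf. Qed.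

Lemma smooth1_continuous f k : smooth1 f -> continuous (derive1n k f).
Proof.
by move=> sf x; apply/differentiable_continuous; rewrite -derivable1_diffP.
Qed.

(** The invariant set for products: sums must be included because the Leibniz rule creates them. *)
Inductive smooth1_alg : set (R -> R) :=
| smooth1_alg_base f of smooth1 f : smooth1_alg f
| smooth1_algD f g of smooth1_alg f & smooth1_alg g : smooth1_alg (f + g)
| smooth1_algM f g of smooth1_alg f & smooth1_alg g : smooth1_alg (f * g).

Lemma smooth1M f g : smooth1 f -> smooth1 g -> smooth1 (f * g).
Proof.
move=> sf sg; apply: (@smooth1_coind smooth1_alg); last first.
  by apply: smooth1_algM; apply: smooth1_alg_base.
move=> {sf sg g}{}f; elim=> {f}[f sf|f g sf [f' sf' df] sg [g' sg' dg]
  |f g sf [f' sf' df] sg [g' sg' dg]].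
- exists (derive1n 1 f); first by apply: smooth1_alg_base; exact: smooth1_derive1n.
  by move=> x; exact: (@smooth1_is_derive f 0).
- by exists (f' + g') => [|x]; [exact: smooth1_algD | exact: is_deriveD].
- exists (f * g' + g * f'); first by apply: smooth1_algD; apply: smooth1_algM.
  by move=> x; exact: is_deriveM.
Qed.

Lemma is_derive_affine (a b x : R) : is_derive x 1 (fun t : R => a + b * t) b.
Proof.
have d := is_deriveD (is_derive_cst a x 1) (is_deriveZ b (is_derive_id x (1 : R))).
by apply: is_derive_eq; rewrite add0r /GRing.scale/= mulr1.
Qed.

Lemma smooth1_affine f (a b : R) :
  smooth1 f -> smooth1 (fun t => f (a + b * t)).
Proof.
move=> sf; pose S : set (R -> R) := [set g | exists (k : R) (h : R -> R), smooth1 h /\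
  g = (fun t => k * h (a + b * t))].
have : S (fun t => f (a + b * t)).
  by exists 1, f; split => //; apply/funext => t; rewrite mul1r.
apply: smooth1_coind => _ [k [h [sh ->]]].
exists (fun t => k * b * (derive1n 1 h) (a + b * t)).
  by exists (k * b), (derive1n 1 h); split => //; exact: smooth1_derive1n.
move=> x; have dh := @smooth1_is_derive h 0 (a + b * x) sh.
have daff := is_derive_affine a b x.
have := @is_derive1_comp _ _ (fun t : R => a + b * t) _ _ _ dh daff;
  rewrite derive1n0 => dc.
by apply: (is_derive_eq (is_deriveZ k dc)); rewrite /GRing.scale/= mulrAC mulrA.
Qed.

Lemma derive1n_affine f (a b : R) k : smooth1 f ->
  derive1n k (fun t => f (a + b * t)) = (fun t =>
    b ^+ k * (derive1n k f) (a + b * t)).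
Proof.
move=> sf; elim: k => [|k IH]; first by apply/funext => t; rewrite expr0 mul1r.
rewrite derive1nS IH; apply/funext => x.
have dh := @smooth1_is_derive f k (a + b * x) sf.
have daff := is_derive_affine a b x.
have dc := @is_derive1_comp _ _ (fun t : R => a + b * t) _ _ _ dh daff.
have dZ := is_deriveZ (b ^+ k) dc.
rewrite derive1E (_ : (fun t =>
  _) = (b ^+ k) \*: ((derive1n k f) \o (fun t : R => a + b * t))) //.
by have [_ ->] := dZ; rewrite /GRing.scale /= exprS; ring.
Qed.

(** The exponential series gives [t^i / i! <= exp t], so each monomial [t^i exp (- t)] is at most
    [i!]. *)
Lemma horner_expRN_bounded P :
  exists C : R, forall t, 0 <= t -> `|P.[t]| * expR (- t) <= C.
Proof.
exists (\sum_(i < size P) `|P`_i| * i`!%:R) => t t0.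
rewrite horner_coef (le_trans (ler_wpM2r (expR_ge0 _) (ler_norm_sum _ _ _)))//.
rewrite mulr_suml ler_sum// => i _; rewrite normrM -mulrA ler_wpM2l//.
rewrite ger0_norm ?exprn_ge0// expRN ler_pdivrMr ?expR_gt0//.
case: (i : nat) => [|k].
  by rewrite expr0 fact0 mul1r; apply: le_trans (expR_ge1Dx _); rewrite lerDl.
rewrite mulrC -ler_pdivrMr ?ltr0n ?fact_gt0//.
by apply: le_trans (expR_ge1Dxn k t0); rewrite lerDr.
Qed.

(** The classical [exp (- 1/x)], extended by 0, with a polynomial factor in [1/x] that makes the
    family stable under derivation: [P] becomes [X^2 (P - P')]. *)
Definition flat P (x : R) : R :=
  if 0 < x then P.[x^-1] * expR (- x^-1) else 0.

(** Gives the derivative 0 at the origin, the only point where differentiating [flat] is not a local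
    computation. *)
Lemma flat_quadratic P : exists C, forall h, `|flat P h| <= C * h ^+ 2.
Proof.
have [C HC] := horner_expRN_bounded ('X^2 * P); exists C => h; rewrite /flat.
have C0 : 0 <= C by apply: le_trans (HC 0 _) => //; rewrite mulr_ge0// expR_ge0.
case: ifPn => [h0|_]; last by rewrite normr0 mulr_ge0// sqr_ge0.
have := HC h^-1; rewrite invr_ge0 ltW// => /(_ erefl).
rewrite hornerM hornerXn !normrM (ger0_norm (expR_ge0 _)) -!expr2.
rewrite gtr0_norm ?invr_gt0// exprVn -mulrA ler_pdivrMl ?exprn_gt0//.
by rewrite [leRHS]mulrC.
Qed.

Lemma is_derive_flat P (x : R) :
  is_derive x 1 (flat P) (flat ('X^2 * (P - P^`())) x).
Proof.
have [x0|x0|->] := ltgtP x 0.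
- apply: (@near_eq_is_derive _ _ _ (cst 0)).
    by near=> y; rewrite /flat ifF//; apply/negbTE; rewrite -leNgt ltW//; near: y;
      exact: lt_nbhsl.
  by rewrite /flat ltNge (ltW x0)/=; exact: is_derive_cst.
- have xN0 : x != 0 by rewrite gt_eqF.
  have dV : is_derive x 1 (fun y : R => y^-1) (- x ^- 2 *: 1) by exact: is_deriveV.
  have dP := is_derive1_comp (is_derive_poly P x^-1) dV.
  have dE := @is_derive1_comp _ _ (fun y : R => - y^-1) _ _ _
    (is_derive_expR (- x^-1)) (is_deriveN dV).
  apply: near_eq_is_derive; last first.
    apply: (is_derive_eq (is_deriveM dP dE)).
    rewrite /flat x0 !hornerE /GRing.scale/= !mulr1 -!exprVn.
    ring.
  by near=> y; rewrite /flat ifT//; near: y; exact: lt_nbhsr.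
- have flat0 Q : flat Q 0 = 0 by rewrite /flat ltxx.
  rewrite flat0; have [C HC] := flat_quadratic P.
  have C0 : 0 <= C by have := HC 1; rewrite expr1n mulr1; exact: le_trans.
  have lim0 : (fun h => h^-1 *: (flat P (h *: 1 + 0) - flat P 0)) @ 0^' --> (0 : R).
    apply/cvgrPdist_le => e e0; near=> h.
    have h0 : h != 0 by near: h; exact: nbhs_dnbhs_neq.
    rewrite flat0 subr0 addr0 sub0r normrN /GRing.scale/= mulr1 normrM normfV.
    rewrite ler_pdivrMl ?normr_gt0// (le_trans (HC h))//.
    rewrite -real_normK ?num_real// expr2 mulrA mulrC ler_wpM2l//.
    apply: (@le_trans _ _ ((C + 1) * `|h|)); first by rewrite ler_wpM2r// lerDl.
    rewrite mulrC -ler_pdivlMr ?ltr_wpDl//.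
    near: h; apply: dnbhs0_le; by rewrite divr_gt0// ltr_wpDl.
  by apply: DeriveDef; [apply/cvg_ex; exists 0 | exact/cvg_lim].
Unshelve. all: by end_near. Qed.

Lemma smooth1_flat P : smooth1 (flat P).
Proof.
apply: (@smooth1_coind (range flat)); last by exists P.
by move=> _ [Q _ <-]; exists (flat ('X^2 * (Q - Q^`()))) => //; exact: is_derive_flat.
Qed.

Lemma smooth1_horner P : smooth1 (horner P).
Proof.
apply: (@smooth1_coind (range horner)); last by exists P.
by move=> _ [Q _ <-]; exists (horner Q^`()) => //; exact: is_derive_poly.
Qed.

Definition bump1 (t : R) : R := flat 1 (1 + t) * flat 1 (1 - t).

Lemma smooth1_bump1 : smooth1 bump1.
Proof.
have := @smooth1M _ _ (@smooth1_affine _ 1 1 (@smooth1_flat 1))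
  (@smooth1_affine _ 1 (-1) (@smooth1_flat 1)).
by congr smooth1; apply/funext => t; rewrite /bump1 fctE mul1r mulN1r.
Qed.

Lemma bump1_ge0 t : 0 <= bump1 t.
Proof.
by rewrite /bump1 /flat !hornerE mulr_ge0//; case: ifP => // _;
  rewrite mul1r expR_ge0.
Qed.

Lemma bump1_lbound : exists2 c : R, 0 < c & forall t, `|t| <= 2^-1 -> c <= bump1 t.
Proof.
exists (expR (-2) * expR (-2)); first by rewrite mulr_gt0// expR_gt0.
move=> t; rewrite ler_norml => /andP[t1 t2].
have H (y : R) : 2^-1 <= y -> expR (-2) <= flat 1 y.
  move=> y2; have y0 : 0 < y by apply: lt_le_trans y2; rewrite invr_gt0.
  rewrite /flat y0 !hornerE ?mul1r ler_expR lerN2.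
  by rewrite -[leRHS]invrK lef_pV2// posrE invr_gt0.
by rewrite /bump1 ler_pM ?expR_ge0// H//; lra.
Qed.

(** The strict inequality defines an open set, so vanishing there passes to the derivative. The
    endpoints are recovered later by continuity. *)
Lemma derive1n_bump1_out k t : 1 < `|t| -> (derive1n k bump1) t = 0.
Proof.
elim: k t => [|k IH] t t1.
  rewrite derive1n0 /bump1; move: t1; rewrite ltr_normr => /orP[]t1.
    by rewrite [flat 1 (1 - t)]/flat ifF ?mulr0//; apply/negbTE; rewrite -leNgt; lra.
  by rewrite [flat 1 (1 + t)]/flat ifF ?mul0r//; apply/negbTE; rewrite -leNgt; lra.
rewrite derive1nS derive1E (@near_eq_derive _ _ _ _ (cst 0)) ?derive_cst//.
near=> y; apply: IH; near: y.
exact: (cvgr_gt `|t| (@norm_continuous _ _ t)).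
Unshelve. all: by end_near. Qed.

Lemma derive1n_bump1_bounded r : exists2 M : R, 1 <= M &
  forall k t, (k <= r)%N -> `|(derive1n k bump1) t| <= M.
Proof.
have H k : exists M : R, forall t, `|(derive1n k bump1) t| <= M.
  have [||c _ Hc] := @EVT_max R (fun t => `|(derive1n k bump1) t|) (-1) 1;
    first by lra.
    apply: continuous_subspaceT => x; apply: continuous_comp;
      last exact: norm_continuous.
    exact: smooth1_continuous smooth1_bump1 _.
  exists `|(derive1n k bump1) c| => t; have [t1|t1] := leP `|t| 1; last first.
    by rewrite derive1n_bump1_out// normr0.
  by apply: Hc; rewrite in_itv/= -ler_norml.
elim: r => [|r [M M1 HM]].
  have [M HM] := H 0%N; exists (Num.max 1 M); first by rewrite le_max lexx.
  by case=> // t _; rewrite le_max HM orbT.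
have [N HN] := H r.+1; exists (Num.max M N); first by rewrite le_max M1.
move=> k t; rewrite leq_eqVlt => /predU1P[->|kr]; first by rewrite le_max HN orbT.
by rewrite le_max HM.
Qed.

End smooth_real_functions.

(** * Sums of products of functions of one variable *)

Section tensors.
Context {R : realType} {n : nat}.
Implicit Types (x : 'rV[R]_n) (k : 'I_n -> nat).

(** Common form of polynomials and bumps. The orders of derivation [k] are a parameter, so that a
    partial derivative merely shifts [k]. *)
Definition tensor (A : finType) (c : A -> R) (f : A -> 'I_n -> R -> R) k x : R :=
  \sum_a c a * \prod_(i < n) derive1n (k i) (f a i) (x ord0 i).

Lemma is_derive_fsum (V : normedModType R) (A : finType) (h : A -> V -> R)
    (dh : A -> R) (x v : V) :
  (forall a, is_derive x v (h a) (dh a)) ->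
  is_derive x v (fun y => \sum_a h a y) (\sum_a dh a).
Proof.
move=> H; rewrite (_ : (fun y => _) = \sum_a h a); last first.
  by apply/funext => y; rewrite fct_sumE.
by apply: (big_ind2 (fun f df => is_derive x v f df)) => // *;
  [exact: is_derive_cst | exact: is_deriveD].
Qed.

Variables (A : finType) (c : A -> R) (f : A -> 'I_n -> R -> R).
Hypothesis sf : forall a i, smooth1 (f a i).
Local Notation tens := (tensor c f).

Lemma is_derive_tensor k x i0 :
  is_derive x (delta_mx 0 i0 : 'rV[R]_n) (tens k)
    (tens (fun i => k i + (i == i0))%N x).
Proof.
(* Along the direction [i0] only the factor of index [i0] moves, so the directional difference
   quotient is that of the one-variable function [W]. *)
pose W (t : R) := \sum_a c a * ((\prod_(i < n | i != i0)
  derive1n (k i) (f a i) (x ord0 i)) * derive1n (k i0) (f a i0) t).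
have dW : is_derive (x ord0 i0) 1 W (tens (fun i => k i + (i == i0))%N x).
  have -> : tens (fun i => k i + (i == i0))%N x = \sum_a c a *: (
    (\prod_(i < n | i != i0) derive1n (k i) (f a i) (x ord0 i)) *:
      derive1n (k i0).+1 (f a i0) (x ord0 i0)).
    apply: eq_bigr => a _; congr (_ * _); rewrite (bigD1 i0)//= eqxx addn1 mulrC.
    by congr (_ * _); apply: eq_bigr => i /negbTE ->; rewrite addn0.
  apply: is_derive_fsum => a.
  have d := smooth1_is_derive (k i0) (x ord0 i0) (@sf a i0).
  exact: (is_deriveZ (c a) (is_deriveZ (\prod_(i < n | i != i0) _) d)).
have E : (fun h : R => h^-1 *: (tens k (h *: (delta_mx 0 i0) + x) - tens k x)) =
    (fun h : R => h^-1 *: (W (h *: 1 + x ord0 i0) - W (x ord0 i0))).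
  apply/funext => h; congr (_ *: (_ - _)); apply: eq_bigr => a _;
    congr (_ * _); rewrite (bigD1 i0)//= mulrC.
    rewrite !mxE !eqxx; congr (_ * _).
    by apply: eq_bigr => i /negbTE ii0; rewrite !mxE ii0 andbF mulr0 add0r.
  by [].
by case: dW => d1 d2; apply: DeriveDef; rewrite /derivable /derive /= E.
Qed.

Lemma partial_tensor k i0 :
  partial i0 (tens k) = tens (fun i => k i + (i == i0))%N.
Proof. by apply/funext => x; have [_] := is_derive_tensor k x i0. Qed.

Lemma pderiv_tensor k (alpha : 'I_n -> nat) :
  pderiv alpha (tens k) = tens (fun i => k i + alpha i)%N.
Proof.
have it m i0 l : iter m (partial i0) (tens l) = tens (fun i => l i + m * (i == i0))%N.
  elim: m => [|m IH]; first by congr tens; apply/funext => i; rewrite mul0n addn0.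
  rewrite iterS IH partial_tensor; congr tens; apply/funext => i.
  by rewrite mulSn -addnA [(m * _ + _)%N]addnC.
rewrite /pderiv.
(* The induction needs an arbitrary list of directions, with multiplicities; in the enumeration of
   ['I_n] each one occurs once. *)
have -> s : foldr (fun i => iter (alpha i) (partial i)) (tens k) s =
    tens (fun i => k i + alpha i * count_mem i s)%N.
  elim: s => [|i0 s IH] /=; first by congr tens; apply/funext => i;
    rewrite muln0 addn0.
  rewrite IH it; congr tens; apply/funext => i; rewrite mulnDr addnCA addnC.
  rewrite [i == i0]eq_sym; congr (_ + _)%N.
  by case: eqVneq => [->|]//=; rewrite !muln0.
by congr tens; apply/funext => i; rewrite count_uniq_mem ?enum_uniq// mem_enum muln1.
Qed.

Lemma continuous_tensor k : continuous (tens k).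
Proof.
rewrite /tensor; apply: (@continuous_big R A +%R) => [|a _];
  first exact: add_continuous.
suff H : continuous (fun x : 'rV[R]_n =>
  \prod_(i < n) derive1n (k i) (f a i) (x ord0 i)).
  by move=> x; apply: cvgMl_tmp; [exact: nbhs_filter|exact: H].
apply: (@continuous_big R 'I_n *%R) => [|i _]; first exact: mul_continuous.
move=> x; apply: (continuous_comp (@coord_continuous _ _ _ ord0 i x)).
exact: (smooth1_continuous (@sf a i)).
Qed.

Lemma measurable_tensor k : measurable_fun [set: 'rV[R]_n] (tens k).
Proof.
apply: measurable_sum => a; apply: measurable_funM; first exact: measurable_cst.
apply: measurable_prod => i _.
apply: (measurableT_comp _ (measurable_rV_coord i)).
by apply: continuous_measurable_fun; exact: smooth1_continuous.
Qed.

Lemma smooth_tensor k : smooth (tens k).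
Proof.
move=> s i x; have [l ->] : exists l, foldr (@partial R n) (tens k) s = tens l.
  elim: s => [|i0 s [l IH]]; first by exists k.
  by rewrite /= IH partial_tensor; eexists.
by split; [exact: continuous_tensor | have [] := is_derive_tensor l x i].
Qed.

End tensors.

(** * Integration over boxes *)

Section product_integrals.
Context {R : realType}.
Local Notation lam := (@lebesgue_measure R).

(** Induction on the dimension: the measure in dimension [n.+1] is the image under [rV_cons] of a
    product measure, to which Tonelli (integrability) and Fubini (value) apply. In dimension 0 the
    measure is a Dirac mass and the empty product is 1. *)
Lemma integrable_rV_prod n (F : 'I_n -> R -> R) :
  (forall i, lam.-integrable setT (EFin \o F i)) ->
  (lebesgue_rV R n).-integrable setT
    (EFin \o (fun x : 'rV[R]_n => \prod_(i < n) F i (x ord0 i))) /\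
  \int[lebesgue_rV R n]_x (\prod_(i < n) F i (x ord0 i)) =
  \prod_(i < n) \int[lam]_t F i t.
Proof.
elim: n F => [F _|n IH F iF].
  have E : (fun x : 'rV[R]_0 => \prod_(i < 0) F i (x ord0 i)) = cst 1.
    by apply/funext => x; rewrite big_ord0.
  have d1 : lebesgue_rV R 0 setT = 1%E by exact: diracT.
  rewrite E; split.
    apply: measurable_bounded_integrable; [by []| |by []|exact: bounded_cst].
    by apply: (@le_lt_trans _ _ 1%E); [rewrite -d1|exact: ltry].
  by rewrite big_ord0 Rintegral_cst// mul1r; exact: (congr1 fine d1).
have [iQ vQ] := IH (fun j => F (lift ord0 j)) (fun j => iF _).
set Q : 'rV[R]_n -> R := fun y => _ in iQ vQ.
pose f (z : measurableTypeR R * 'rV[R]_n) : \bar R := (F ord0 z.1 * Q z.2)%:E.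
set P : 'rV[R]_n.+1 -> R := fun x => _.
have mF i : measurable_fun [set: measurableTypeR R] (F i).
  by apply/measurable_EFinP; exact: measurable_int (iF i).
have mQ : measurable_fun [set: 'rV[R]_n] Q.
  by apply/measurable_EFinP; exact: measurable_int iQ.
have mP : measurable_fun [set: 'rV[R]_n.+1] (EFin \o P).
  apply/measurable_EFinP; apply: measurable_prod => i _.
  exact: (measurableT_comp (mF i) (measurable_rV_coord i)).
have Pf : (EFin \o P) \o @rV_cons R n = f.
  apply/funext => -[t y]; rewrite /f /P /= big_ord_recl mxE unlift_none;
    congr (_ * _)%:E.
  by apply: eq_bigr => j _; rewrite mxE liftK.
have mf : measurable_fun setT f.
  apply/measurable_EFinP; apply: measurable_funM.
    exact: (measurableT_comp (mF ord0) measurable_fst).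
  exact: (measurableT_comp mQ measurable_snd).
have iF0 := iF ord0.
have if_ : (lam \x lebesgue_rV R n)%E.-integrable setT f.
  apply/integrable12ltyP => //.
  rewrite (_ : (fun x => _) = fun x =>
    (`|(F ord0 x)%:E| * \int[lebesgue_rV R n]_y `|(Q y)%:E|)%E); last first.
    apply/funext => x; rewrite -ge0_integralZl//;
      last by apply: measurableT_comp => //; exact: measurable_int iQ.
    by apply: eq_integral => y _; rewrite /f /= normrM EFinM.
  move/integrableP: iQ => [_ ooQ]; move/integrableP: (iF0) => [mF0 ooF].
  rewrite ge0_integralZr//; last 2 first.
    exact: measurableT_comp.
    exact: integral_ge0.
  by rewrite lte_mul_pinfty// ?integral_ge0// ge0_fin_numE// integral_ge0.
have if' : (lam \x lebesgue_rV R n)%E.-integrable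
    (@rV_cons R n @^-1` setT) ((EFin \o P) \o @rV_cons R n) by rewrite preimage_setT
      Pf.
split.
  exact: (integrable_pushforward (@measurable_rV_cons R n) mP if' measurableT).
have -> : \int[lebesgue_rV R n.+1]_x P x = fine (\int[(lam \x lebesgue_rV R n)%E]_z
  f z)%E.
  congr fine; rewrite -Pf -(preimage_setT (@rV_cons R n)).
  exact: (integral_pushforward (@measurable_rV_cons R n) mP if' measurableT).
rewrite -integral12_prod_meas1//= /fubini_F big_ord_recl -vQ.
rewrite (_ : (fun x => _) = (fun x =>
  (F ord0 x)%:E * \int[lebesgue_rV R n]_y (Q y)%:E)%E); last first.
  apply/funext => x; rewrite -integralZl//.
have fQ : (\int[lebesgue_rV R n]_y (Q y)%:E)%E \is a fin_num by exact:
  integrable_fin_num.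
by rewrite -(fineK fQ) integralZr// fineM//; exact: integrable_fin_num.
Qed.

End product_integrals.

Section boxes.
Context {R : realType}.
Local Notation lam := (@lebesgue_measure R).

Definition rbox n (J : 'I_n -> set R) : set 'rV[R]_n :=
  [set x | forall i, J i (x ord0 i)].

Lemma measurable_rbox n (J : 'I_n -> set R) :
  (forall i, measurable (J i)) -> measurable (rbox J).
Proof.
move=> mJ; rewrite (_ : rbox J = \bigcap_(i in [set: 'I_n]) (rV_coord i @^-1` J i)).
  apply: fin_bigcap_measurable => [|i _]; first exact: finite_finset.
  by rewrite -[X in measurable X]setTI; exact: measurable_rV_coord.
by apply/seteqP; split => x Jx i; have := Jx i => //; exact.
Qed.

Lemma restrict_rbox n (J : 'I_n -> set R) (F : 'I_n -> R -> R) :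
  (fun x : 'rV[R]_n => \prod_(i < n) F i (x ord0 i)) \_ (rbox J) =
  (fun x : 'rV[R]_n => \prod_(i < n) (F i \_ (J i)) (x ord0 i)).
Proof.
apply/funext => x; rewrite patchE; case: ifPn => [|/negP].
  by rewrite inE => Jx; apply: eq_bigr => i _; rewrite patchE mem_set.
rewrite inE => /existsNP[i Ji]; rewrite (bigD1 i)//= patchE ifF ?mul0r//.
by apply/negbTE/negP; rewrite inE.
Qed.

Lemma integrable_rbox_prod n (J : 'I_n -> set R) (F : 'I_n -> R -> R) :
  (forall i, measurable (J i)) ->
  (forall i, lam.-integrable (J i) (EFin \o F i)) ->
  (lebesgue_rV R n).-integrable (rbox J)
    (EFin \o (fun x : 'rV[R]_n => \prod_(i < n) F i (x ord0 i))) /\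
  \int[lebesgue_rV R n]_(x in rbox J) (\prod_(i < n) F i (x ord0 i)) =
  \prod_(i < n) \int[lam]_(t in J i) F i t.
Proof.
move=> mJ iF; have iF' i : lam.-integrable setT (EFin \o (F i \_ (J i))).
  rewrite -restrict_EFin; apply/integrable_restrict => //=; first exact: mJ.
  by rewrite setTI; exact: iF.
have [i1 i2] := integrable_rV_prod iF'; split.
  rewrite -[rbox J]setTI; apply/integrable_restrict => //.
    exact: measurable_rbox.
  by rewrite restrict_EFin restrict_rbox.
rewrite Rintegral_mkcond restrict_rbox i2; apply: eq_bigr => i _.
by rewrite [RHS]Rintegral_mkcond.
Qed.

Lemma lebesgue_rbox n (J : 'I_n -> set R) : (forall i, measurable (J i)) ->
  (forall i, (lam (J i) < +oo)%E) ->
  lebesgue_rV R n (rbox J) = (\prod_(i < n) fine (lam (J i)))%:E.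
Proof.
move=> mJ fJ.
have i1 i : lam.-integrable (J i) (EFin \o cst 1).
  apply: measurable_bounded_integrable; [exact: mJ|exact: fJ|exact: measurable_cst|].
  exact: bounded_cst.
have [iB vB] := integrable_rbox_prod mJ i1.
have mB := measurable_rbox mJ.
have E : (fun x : 'rV[R]_n => \prod_(i < n) cst 1 (x ord0 i)) = cst (1 : R).
  by apply/funext => x; rewrite big1.
rewrite E in iB vB; rewrite (_ : \prod_(i < n) _ = \prod_(i < n) \int[lam]_(t in J
  i) cst 1 t).
  rewrite -vB Rintegral_cst// mul1r fineK//.
  have : (\int[lebesgue_rV R n]_(x in rbox J) cst 1%:E x)%E \is a fin_num.
    exact: integrable_fin_num.
  by rewrite integral_cst// mul1e.
by apply: eq_bigr => i _; have := Rintegral_cst lam (mJ i) 1; rewrite mul1r => <-.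
Qed.

Definition cube n (c : 'rV[R]_n) (rho : R) : set 'rV[R]_n :=
  rbox (fun i => `[c ord0 i - rho, c ord0 i + rho]%classic).

Lemma cubeP n (c : 'rV[R]_n) rho x :
  cube c rho x <-> forall i, `|x ord0 i - c ord0 i| <= rho.
Proof.
by split => H i; have := H i; rewrite /= in_itv/= ler_norml;
  case/andP => ? ?; apply/andP; split; lra.
Qed.

Lemma measurable_cube n (c : 'rV[R]_n) rho : measurable (cube c rho).
Proof. by apply: measurable_rbox => i; exact: measurable_itv. Qed.

Lemma compact_cube n (c : 'rV[R]_n) rho : compact (cube c rho).
Proof. by apply: rV_compact => i; exact: segment_compact. Qed.

Lemma lebesgue_cube n (c : 'rV[R]_n) rho : 0 <= rho ->
  lebesgue_rV R n (cube c rho) = ((2 * rho) ^+ n)%:E.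
Proof.
move=> rho0; have E i : lam `[c ord0 i - rho, c ord0 i + rho]%classic = (2 * rho)%:E.
  rewrite lebesgue_measure_itv/= lte_fin.
  case: ltP => [_|h]; first by rewrite -EFinB; congr EFin; lra.
  by congr EFin; lra.
rewrite lebesgue_rbox => [|i|i]; [|exact: measurable_itv|by rewrite E ltry].
by under eq_bigr do rewrite E/=; rewrite prodr_const card_ord.
Qed.

Lemma integrable_cube_prod n (c : 'rV[R]_n) rho (F : 'I_n -> R -> R) :
  (forall i, continuous (F i)) ->
  (lebesgue_rV R n).-integrable (cube c rho)
    (EFin \o (fun x : 'rV[R]_n => \prod_(i < n) F i (x ord0 i))) /\
  \int[lebesgue_rV R n]_(x in cube c rho) (\prod_(i < n) F i (x ord0 i)) =
  \prod_(i < n) \int[lam]_(t in `[c ord0 i - rho, c ord0 i + rho]) F i t.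
Proof.
move=> cF; apply: integrable_rbox_prod => i; first exact: measurable_itv.
apply: continuous_compact_integrable; first exact: segment_compact.
exact: continuous_subspaceT.
Qed.

(** All derivatives of [B] vanish at both endpoints, so none of the [k] integrations leaves a
    boundary term. *)
Lemma integral_by_parts (P B : R -> R) (a b : R) k : smooth1 P -> smooth1 B ->
  a < b -> (forall l, derive1n l B a = 0) -> (forall l, derive1n l B b = 0) ->
  \int[lam]_(t in `[a, b]) (P t * derive1n k B t) =
  (-1) ^+ k * \int[lam]_(t in `[a, b]) (derive1n k P t * B t).
Proof.
move=> sP sB ab Ba Bb; elim: k P sP => [|k IH] P sP; first by rewrite expr0 mul1r.
have LR f : smooth1 f -> derivable_oo_LRcontinuous f a b.
  move=> sf; split; first by move=> x _; exact: (sf 0%N).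
    by apply: cvg_at_right_filter; exact: (@smooth1_continuous _ f 0%N).
  by apply: cvg_at_left_filter; exact: (@smooth1_continuous _ f 0%N).
have sBk := @smooth1_derive1n _ _ k sB.
have := @integration_by_parts _ P (derive1n k B) (derive1n 1 P) (derive1n k.+1 B) a
  b ab.
move=> /(_ (continuous_subspaceT (@smooth1_continuous _ P 1 sP))) /(_ (LR _ sP)).
move=> /(_ (fun _ _ => erefl)) /(_ (continuous_subspaceT (@smooth1_continuous _ B
  k.+1 sB))).
move=> /(_ (LR _ sBk)) /(_ (fun _ _ => erefl)).
rewrite Ba Bb !mulr0 subr0 add0e => /(congr1 fine).
rewrite fineN -/(Rintegral _ _ _) => ->.
rewrite -[in X in - X]/(Rintegral _ _ _) IH; last exact: (@smooth1_derive1n _ _ 1).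
rewrite exprS mulN1r mulNr; congr (- (_ * _)).
by rewrite (derive1Sn P k).
Qed.

End boxes.

(** * Bumps *)

Lemma Rintegral_fsum d (T : measurableType d) (R : realType)
    (nu : {measure set T -> \bar R}) (A : finType) (D : set T) (F : A -> T -> R) :
  measurable D -> (forall a, nu.-integrable D (EFin \o F a)) ->
  \int[nu]_(x in D) (\sum_a F a x) = \sum_a \int[nu]_(x in D) F a x.
Proof.
move=> mD iF; rewrite /Rintegral.
under eq_integral do rewrite -sumEFin.
rewrite integral_sum//; apply: EFin_inj; rewrite -sumEFin fineK.
  by apply: eq_bigr => a _; rewrite fineK//; exact: (integrable_fin_num mD (iF a)).
by apply/sum_fin_numP => a _ _; exact: (integrable_fin_num mD (iF a)).
Qed.

Lemma lebesgue_cube_lty (R : realType) n (c : 'rV[R]_n) rho :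
  (lebesgue_rV R n (cube c rho) < +oo)%E.
Proof.
have [rho0|rho0] := leP 0 rho; first by rewrite lebesgue_cube// ltry.
apply: (@le_lt_trans _ _ (lebesgue_rV R n (cube c `|rho|))); last first.
  by rewrite lebesgue_cube// ltry.
apply: le_measure; rewrite ?inE; [exact: measurable_cube..|].
by move=> x /cubeP H; apply/cubeP => i; exact: le_trans (H i) (ler_norm _).
Qed.

Section bumps.
Context {R : realType} {n : nat}.
Implicit Types (c x : 'rV[R]_n) (rho : R) (k : 'I_n -> nat).
Local Notation lam := (@lebesgue_measure R).
Local Notation mu := (lebesgue_rV R n).

Definition bump_factor c rho (i : 'I_n) (t : R) : R :=
  bump1 (- (c ord0 i / rho) + rho^-1 * t).

(** The bump itself is the case [k = 0]; the other [k] are its partial derivatives. The one-element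
    index type presents a single product as a [tensor]. *)
Definition bump c rho k : 'rV[R]_n -> R :=
  tensor (fun _ : 'I_1 => 1) (fun _ => bump_factor c rho) k.

Lemma smooth1_bump_factor c rho i : smooth1 (bump_factor c rho i).
Proof. exact: (@smooth1_affine _ bump1 (- (c ord0 i / rho)) rho^-1 (@smooth1_bump1
  R)). Qed.

Lemma derive1n_bump_factor c rho i (k : nat) t : derive1n k (bump_factor c rho i) t =
  rho ^- k * derive1n k bump1 ((t - c ord0 i) / rho).
Proof.
rewrite (congr1 (@^~ t) (@derive1n_affine _ bump1 (- (c ord0 i / rho)) rho^-1 k
  (@smooth1_bump1 R))).
by rewrite exprVn; congr (_ * derive1n k bump1 _); ring.
Qed.

Lemma bumpE c rho k x :
  bump c rho k x = \prod_(i < n) derive1n (k i) (bump_factor c rho i) (x ord0 i).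
Proof. by rewrite /bump /tensor big_ord1 mul1r. Qed.

Lemma bumpM c rho k x : bump c rho k x = rho ^- (mlen k) *
  \prod_(i < n) derive1n (k i) bump1 ((x ord0 i - c ord0 i) / rho).
Proof.
rewrite bumpE /mlen -prodrXr -prodfV -big_split/=.
by apply: eq_bigr => i _; rewrite derive1n_bump_factor.
Qed.

Lemma pderiv_bump alpha c rho k :
  pderiv alpha (bump c rho k) = bump c rho (fun i => k i + alpha i)%N.
Proof. by apply: pderiv_tensor => _ i; exact: smooth1_bump_factor. Qed.

Lemma measurable_bump c rho k : measurable_fun setT (bump c rho k).
Proof. by apply: measurable_tensor => _ i; exact: smooth1_bump_factor. Qed.

Lemma derive1n_bump_factor_end c rho i (k : nat) : 0 < rho ->
  derive1n k (bump_factor c rho i) (c ord0 i - rho) = 0 /\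
  derive1n k (bump_factor c rho i) (c ord0 i + rho) = 0.
Proof.
move=> rho0; have cont := @smooth1_continuous _ _ k (@smooth1_bump_factor c rho i).
have out t : rho < `|t - c ord0 i| -> derive1n k (bump_factor c rho i) t = 0.
  move=> h; rewrite derive1n_bump_factor derive1n_bump1_out ?mulr0//.
  by rewrite normrM normfV (gtr0_norm rho0) ltr_pdivlMr// mul1r.
(* A nonzero value at an endpoint would persist, by continuity, at nearby points outside the
   interval, where the derivative is zero. *)
split; apply/eqP/negPn/negP => neq0.
- near (c ord0 i - rho)^'- => t.
  have tl : t < c ord0 i - rho by [].
  suff : derive1n k (bump_factor c rho i) t != 0 by rewrite out ?eqxx// ltr0_norm;
    lra.
  by near: t; apply: cvgr_neq0 neq0; apply: cvg_at_left_filter; exact: cont.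
- near (c ord0 i + rho)^'+ => t.
  have tl : c ord0 i + rho < t by [].
  suff : derive1n k (bump_factor c rho i) t != 0 by rewrite out ?eqxx// gtr0_norm;
    lra.
  by near: t; apply: cvgr_neq0 neq0; apply: cvg_at_right_filter; exact: cont.
Unshelve. all: by end_near. Qed.

Lemma bump_out c rho k x : 0 < rho -> ~ cube c rho x -> bump c rho k x = 0.
Proof.
move=> rho0 /cubeP/existsNP[i]; move/negP; rewrite -ltNge => h.
rewrite bumpM (bigD1 i)//= derive1n_bump1_out ?mul0r ?mulr0//.
by rewrite normrM normfV (gtr0_norm rho0) ltr_pdivlMr// mul1r.
Qed.

Lemma test_function_bump G c rho k : 0 < rho -> cube c rho `<=` G ->
  test_function G (bump c rho k).
Proof.
move=> rho0 sG; split; first by apply: smooth_tensor => _ i;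
  exact: smooth1_bump_factor.
exists (cube c rho); split => //; first exact: compact_cube.
by move=> x; exact: bump_out.
Qed.

(** [M] does not depend on the centre or the size: by [bumpM] rescaling contributes exactly
    [rho ^- (mlen k)]. This is the source of the powers of the mesh size in the final bounds. *)
Lemma bump_bounded r : exists2 M : R, 1 <= M & forall c rho k x, 0 < rho ->
  (forall i, k i <= r)%N -> `|bump c rho k x| <= M * rho ^- (mlen k).
Proof.
have [M M1 HM] := @derive1n_bump1_bounded R r.
exists (M ^+ n); first by rewrite exprn_ege1.
move=> c rho k x rho0 kr;
  have r0 : 0 <= rho ^- mlen k by rewrite invr_ge0 exprn_ge0// ltW.
rewrite bumpM normrM (ger0_norm r0) [leRHS]mulrC ler_wpM2l// normr_prod.
rewrite -[n in M ^+ n]card_ord -prodr_const; apply: ler_prod => i _.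
by rewrite normr_ge0 HM.
Qed.

Lemma bump_ge0 c rho x : 0 <= bump c rho (fun=> 0%N) x.
Proof. by rewrite bumpE; apply: prodr_ge0 => i _; exact: bump1_ge0. Qed.

Lemma bump_lbound : exists2 b : R, 0 < b & forall c rho x, 0 < rho ->
  cube c (rho / 2) x -> b <= bump c rho (fun=> 0%N) x.
Proof.
have [b b0 Hb] := @bump1_lbound R; exists (b ^+ n); first exact: exprn_gt0.
move=> c rho x rho0 /cubeP cx; rewrite bumpM /mlen big1// expr0 invr1 mul1r.
rewrite -[n in b ^+ n]card_ord -prodr_const; apply: ler_prod => i _.
rewrite (ltW b0)/= Hb// normrM normfV (gtr0_norm rho0) ler_pdivrMr// mulrC.
exact: cx.
Qed.

Lemma integrable_tensor_cube (A : finType) (a : A -> R) (f : A -> 'I_n -> R ->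
  R) k c rho :
  (forall b i, smooth1 (f b i)) ->
  mu.-integrable (cube c rho) (EFin \o tensor a f k).
Proof.
move=> sf; apply: measurable_bounded_integrable; first exact: measurable_cube.
- exact: lebesgue_cube_lty.
- by apply: measurable_funTS; exact: measurable_tensor.
- have := @continuous_compact _ _ (tensor a f k) (cube c rho).
  move=> /(_ (continuous_subspaceT (continuous_tensor sf (k := k)))) /(_
    (@compact_cube _ _ _ _)).
  move=> /compact_bounded[M [Mr HM]]; exists M; split => // y My x Cx.
  by apply: HM => //; exists x.
Qed.

(** Integration by parts is done monomial by monomial, coordinate by coordinate. The monomials must
    then be summed again, since only their combination [P], and not each of them, is known to have a
    zero derivative of order [gamma]. *)
Lemma integral_poly_bump r (P : 'rV[R]_n -> R) (gamma : 'I_n -> nat) c rho :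
  0 < rho -> poly_fun r P -> (forall x, cube c rho x -> pderiv gamma P x = 0) ->
  \int[mu]_(x in cube c rho) (P x * bump c rho gamma x) = 0.
Proof.
move=> rho0 [a Pa] DP.
pose f (al : {ffun 'I_n -> 'I_r}) (i : 'I_n) : R -> R := horner 'X^(al i).
have sf al i : smooth1 (f al i) by exact: smooth1_horner.
have PE : P = tensor a f (fun=> 0%N).
  apply/funext => x; rewrite Pa; apply: eq_bigr => al _; congr (_ * _).
  by apply: eq_bigr => i _; rewrite derive1n0 /f hornerXn.
pose F al i t := f al i t * derive1n (gamma i) (bump_factor c rho i) t.
pose H al i t := derive1n (gamma i) (f al i) t * bump_factor c rho i t.
have sb i := @smooth1_bump_factor c rho i.
have cF al i : continuous (F al i).
  move=> t; apply: cvgM; [exact: (@smooth1_continuous _ _ 0%N (@sf al i))|].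
  exact: (@smooth1_continuous _ _ (gamma i) (@sb i)).
have cH al i : continuous (H al i).
  move=> t; apply: cvgM; [exact: (@smooth1_continuous _ _ (gamma i) (@sf al i))|].
  exact: (@smooth1_continuous _ _ 0%N (@sb i)).
have iF al := integrable_cube_prod c rho (cF al).
have iH al := integrable_cube_prod c rho (cH al).
have mC := @measurable_cube _ _ c rho.
have FH al i : \int[lam]_(t in `[c ord0 i - rho, c ord0 i + rho]) F al i t =
    (-1) ^+ gamma i * \int[lam]_(t in `[c ord0 i - rho, c ord0 i + rho]) H al i t.
  apply: integral_by_parts => //; first by lra.
    by move=> l; have [] := derive1n_bump_factor_end c i l rho0.
  by move=> l; have [] := derive1n_bump_factor_end c i l rho0.
have -> : (fun x => P x * bump c rho gamma x) =
    (fun x => \sum_al a al * \prod_(i < n) F al i (x ord0 i)).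
  apply/funext => x; rewrite Pa bumpE mulr_suml; apply: eq_bigr => al _.
  rewrite -mulrA -big_split; congr (_ * _); apply: eq_bigr => i _.
  by rewrite /F /f hornerXn.
rewrite Rintegral_fsum//; last first.
  move=> al; have [i1 _] := iF al.
  by have := integrableZl mC (a al) i1; apply: eq_integrable.
transitivity ((-1) ^+ mlen gamma * \int[mu]_(x in cube c rho)
    (\sum_al a al * \prod_(i < n) H al i (x ord0 i))).
  rewrite Rintegral_fsum//; last first.
    move=> al; have [i1 _] := iH al.
    by have := integrableZl mC (a al) i1; apply: eq_integrable.
  rewrite mulr_sumr; apply: eq_bigr => al _.
  have [i1 v1] := iF al; have [i2 v2] := iH al.
  rewrite !RintegralZl// v1 v2 mulrCA; congr (_ * _).
  by rewrite /mlen -prodrXr -big_split/=; apply: eq_bigr => i _; rewrite FH.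
rewrite (_ : (fun x => \sum_al _) = (fun x =>
  pderiv gamma P x * bump c rho (fun=> 0%N) x)).
  rewrite (@eq_Rintegral _ _ _ _ _ (cst 0)) ?Rintegral_cst ?mul0r ?mulr0//.
  by move=> x; rewrite inE => Cx; rewrite DP// mul0r.
apply/funext => x; rewrite PE pderiv_tensor// bumpE mulr_suml; apply: eq_bigr => al _.
by rewrite -mulrA -big_split; congr (_ * _); apply: eq_bigr => i _.
Qed.

End bumps.

(** * The error on one element *)

(** Hoelder's inequality against the indicator of [C]. The exponent [1 - fine (q^-1)] covers all
    cases at once, being 1 for [q = +oo] and 0 for [q = 1]. *)
Lemma integral_le_Lnorm d (T : measurableType d) (R : realType)
    (nu : {measure set T -> \bar R}) (C D : set T) (w : T -> R) (q : \bar R) :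
  measurable C -> measurable D -> C `<=` D -> (0 < nu C)%E -> (nu C < +oo)%E ->
  (1 <= q)%E -> measurable_fun D w ->
  (\int[nu]_(x in C) `|(w x)%:E| <=
   (fine (nu C) `^ (1 - fine (q^-1)))%:E * Lnorm nu q (fun x => (\1_D x * w x)%:E))%E.
Proof.
move=> mC mD CD C0 Coo q1 mw.
have wE : (fun x => \1_D x * w x) = w \_ D.
  apply/funext => x; rewrite patchE indicE; case: ifPn => xD; first by rewrite mul1r.
  by rewrite mul0r.
have m1w : measurable_fun setT (fun x => \1_D x * w x).
  by rewrite wE; apply/(measurable_restrictT _ mD).1.
have mwC : measurable_fun C w by exact: measurable_funS mw.
have fC : nu C \is a fin_num by rewrite ge0_fin_numE// ltW.
have CE : (\int[nu]_(x in C) `|(w x)%:E| = \int[nu]_x `|(\1_D x * w x * \1_C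
  x)%:E|)%E.
  rewrite integral_mkcond; apply: eq_integral => x _.
  rewrite patchE !indicE; case: ifPn => xC; last by rewrite mulr0 abse0.
  by rewrite mulr1 mem_set ?mul1r//; apply: CD; rewrite inE in xC.
case: q q1 => [q| |//]; last first.
  move=> _; rewrite invey/= subr0 powRr1 ?fine_ge0// fineK// unlock/=.
  have T0 : (0 < nu setT)%E.
    by apply: lt_le_trans C0 _; apply: le_measure; rewrite ?inE.
  rewrite T0; set es := ess_sup _ _.
  have es0 : (0 <= es)%E by apply: ess_sup_gee => //; apply: aeW => x /=.
  rewrite muleC -integral_cst//; apply: ae_ge0_le_integral => //.
  - by apply/measurable_EFinP; apply: measurableT_comp.
  - have := ess_sup_ge nu (abse \o (fun x => (\1_D x * w x)%:E)).
    apply: filterS => x /= + Cx; rewrite indicE mem_set ?mul1r//; exact: CD.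
(* For [q = 1] the conjugate exponent is infinite and [(1 - q^-1)^-1] would have the default value
   0, so this case is treated directly. *)
rewrite lee_fin le_eqVlt => /predU1P[<-|q1].
  rewrite inver oner_eq0 /= invr1 subrr powRr0 mul1e Lnorm1 CE.
  apply: ge0_le_integral => //.
  - apply/measurable_EFinP; apply: measurableT_comp => //.
    by apply: measurable_funM => //; exact: measurable_indic.
  - by apply/measurable_EFinP; apply: measurableT_comp.
  - move=> x _; rewrite lee_fin normrM ler_piMr//.
    by rewrite indicE; case: (x \in C); rewrite ?normr1 ?normr0.
have q0 : 0 < q by rewrite (lt_trans _ q1).
have qN0 : q != 0 by rewrite gt_eqF.
rewrite inver (negbTE qN0)/=.
have V1 : 0 < 1 - q^-1 by rewrite subr_gt0 invf_lt1.
have := @hoelder _ _ _ nu _ (\1_C) q (1 - q^-1)^-1 m1w (measurable_indic mC) q0.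
rewrite invr_gt0 V1 invrK addrC subrK => /(_ erefl erefl).
have -> : Lnorm nu ((1 - q^-1)^-1)%:E (EFin \o \1_C) = (fine (nu C) `^ (1 - q^-1))%:E.
  rewrite unlock (_ : (fun x => _) = (fun x => (\1_C x)%:E)).
    by rewrite integral_indic// setIT invrK -[in LHS](fineK fC) poweR_EFin.
  apply/funext => x; rewrite /= indicE.
  case: (x \in C); rewrite /= ?normr1 ?powR1//.
  by rewrite ?mulr0n ?normr0 powR0 ?invr_neq0 ?gt_eqF.
by rewrite Lnorm1 -CE muleC.
Qed.

Section local_estimate.
Context {R : realType} {n : nat}.
Implicit Types (c x : 'rV[R]_n) (rho : R) (D G : set 'rV[R]_n)
  (u g w P : 'rV[R]_n -> R) (alpha gamma : 'I_n -> nat).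
Local Notation mu := (lebesgue_rV R n).

Lemma sub_multiindex gamma j : (j <= mlen gamma)%N ->
  exists2 beta : 'I_n -> nat, (forall i, beta i <= gamma i)%N & mlen beta = j.
Proof.
elim: j => [_|j IH jg]; first by exists (fun=> 0%N) => //; rewrite /mlen big1.
have [beta bg bj] := IH (ltnW jg).
have [i0 Hi0] : exists i0, (beta i0 < gamma i0)%N.
  apply/not_existsP => H; move: jg; rewrite ltnNge -bj /mlen leq_sum// => i _.
  by rewrite leqNgt; apply/negP; exact: H.
exists (fun i => beta i + (i == i0))%N => [i|].
  by case: eqVneq => [->|]; rewrite ?addn1 ?addn0.
rewrite /mlen big_split/= -/(mlen beta) bj (bigD1 i0)//= eqxx big1 ?addn1//.
by move=> i /negbTE ->.
Qed.

Lemma Lp_norm_le_sobolev (j : nat) (q : \bar R) D w beta : (1 <= q)%E ->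
  (mlen beta <= j)%N ->
  (Lp_norm D q (wderiv D beta w) <= sobolev_norm j q D w)%E.
Proof.
move=> q1 bj; rewrite /sobolev_norm; case: ifPn => [_|]; last by rewrite leey.
(* [inord] truncates nothing: each [beta i] is at most [mlen beta], hence at most [j]. *)
pose b : midx n j := [ffun i => inord (beta i)].
have bE : mval b = beta.
  apply/funext => i; rewrite /mval ffunE inordK// ltnS (leq_trans _ bj)//.
  by rewrite /mlen (bigD1 i)//= leq_addr.
case: q q1 => [q| |//]; last first.
  by move=> _; rewrite -bE;
    apply: (@le_bigmax_cond _ _ _ _ b (fun al => mlen (mval al) <= j)%N
    (fun al => Lp_norm D +oo%E (wderiv D (mval al) w))); rewrite bE.
rewrite lee_fin => q1; have qN0 : q != 0 by rewrite gt_eqF// (lt_le_trans ltr01).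
rewrite -[leLHS]poweRe1 ?Lnorm_ge0// -(mulfV qN0) poweRrM.
apply: gt0_ler_poweR.
- by rewrite invr_ge0 (le_trans ler01).
- by rewrite in_itv/= poweR_ge0 leey.
- by rewrite in_itv/= leey andbT; apply: sume_ge0 => a _; exact: poweR_ge0.
- rewrite (bigD1 b) ?bE//= leeDl//.
  by apply: sume_ge0 => a _; exact: poweR_ge0.
Qed.

Lemma integrable_mul_bump w c rho k : 0 < rho ->
  mu.-integrable (cube c rho) (EFin \o w) ->
  mu.-integrable (cube c rho) (EFin \o (fun x => w x * bump c rho k x)).
Proof.
move=> rho0 iw; have [M M1 HM] := @bump_bounded R n (\max_i k i)%N.
apply: (integrableMl (measurable_cube c rho) iw).
  by apply: measurable_funTS; exact: measurable_bump.
exists (M * rho ^- mlen k); split; first exact: num_real.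
move=> y My x Cx /=; rewrite (le_trans _ (ltW My))// HM// => i.
exact: leq_bigmax.
Qed.

Lemma Rintegral_support D C w : C `<=` D -> (forall x, ~ C x -> w x = 0) ->
  \int[mu]_(x in D) w x = \int[mu]_(x in C) w x.
Proof.
move=> CD w0; rewrite Rintegral_mkcond [RHS]Rintegral_mkcond.
apply: eq_Rintegral => x _; rewrite !patchE.
case: ifPn => xD; case: ifPn => xC //.
  by apply: w0 => Cx; move/negP: xC; rewrite inE.
by rewrite w0// => Cx; move/negP: xD; apply; rewrite inE; exact: CD.
Qed.

Lemma weak_deriv_bump D alpha w g c rho k : 0 < rho -> cube c rho `<=` D ->
  is_weak_deriv D alpha w g ->
  \int[mu]_(x in cube c rho) (w x * bump c rho (fun i => k i + alpha i)%N x) =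
  (-1) ^+ mlen alpha * \int[mu]_(x in cube c rho) (g x * bump c rho k x).
Proof.
move=> rho0 CD [_ _ /(_ _ (test_function_bump k rho0 CD))].
rewrite pderiv_bump (Rintegral_support CD); last first.
  by move=> x Cx; rewrite bump_out// mulr0.
by rewrite (Rintegral_support CD)// => x Cx; rewrite bump_out// mulr0.
Qed.

(* Duality: tested against a bump on which D^gamma P vanishes, D^gamma u is
   seen as the D^beta of the error, with beta <= gamma of length j. *)
Lemma bump_duality (r j : nat) : (j <= r)%N -> exists2 M : R, 0 < M &
  forall (q : \bar R) D G u g P gamma (r' : nat) c rho,
    (1 <= q)%E -> 0 < rho -> measurable D -> cube c rho `<=` D -> D `<=` G ->
    is_weak_deriv G gamma u g -> mlen gamma = r -> poly_fun r' P ->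
    (forall x, cube c rho x -> pderiv gamma P x = 0) ->
  ((`|\int[mu]_(x in cube c rho) (g x * bump c rho (fun=> 0%N) x)|)%:E <=
   (M * rho ^- (r - j) * ((2 * rho) ^+ n) `^ (1 - fine (q^-1)%E))%:E *
     sobolev_norm j q D (fun x => u x - P x)%R)%E.
Proof.
move=> jr; have [M M1 HM] := @bump_bounded R n r.
exists M => [|q D G u g P gamma r' c rho q1 rho0 mD CD DG ug gr Pp DP].
  exact: lt_le_trans ltr01 M1.
have M0 : 0 < M := lt_le_trans ltr01 M1.
have A0 : 0 < M * rho ^- (r - j) * ((2 * rho) ^+ n) `^ (1 - fine (q^-1)%E).
  by rewrite !mulr_gt0// ?invr_gt0 ?exprn_gt0// powR_gt0// exprn_gt0// mulr_gt0.
have [beta bg bj] : exists2 beta : 'I_n ->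
  nat, (forall i, beta i <= gamma i)%N & mlen beta = j.
  by apply: sub_multiindex; rewrite gr.
(* Without a weak derivative of order [beta] the Sobolev norm of the error is [+oo], and the
   positive factor in front keeps the right-hand side infinite. *)
have [wd|nwd] := pselect (exists d, is_weak_deriv D beta (fun x => u x - P x) d);
  last first.
  rewrite /sobolev_norm; case: ifPn => [/asboolP/(_ beta)|_].
    by rewrite bj => /(_ (leqnn _)).
  by rewrite gt0_muley ?lte_fin// leey.
set e := (fun x => u x - P x) in wd *.
have de : is_weak_deriv D beta e (wderiv D beta e).
  have [d Hd] := wd; exact: (xgetPex (cst 0) wd).
set d := wderiv D beta e in de *.
apply: le_trans (lee_wpmul2l _ (@Lp_norm_le_sobolev j q D e beta q1 _)); last 2 first.
  by rewrite lee_fin ltW.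
  by rewrite bj.
rewrite -/d.
have mC := @measurable_cube R n c rho.
have kC := @compact_cube R n c rho.
have CG := subset_trans CD DG.
have [[mu_ iu] [mg ig] _] := ug.
have [[me ie] [md id_] _] := de.
pose k i := (gamma i - beta i)%N.
have kbg : (fun i => k i + beta i)%N = gamma.
  by apply/funext => i; rewrite /k subnK.
have mk : mlen k = (r - j)%N.
  by rewrite /mlen /k sumnB -?/(mlen _) ?gr ?bj.
have E1 := weak_deriv_bump k rho0 CD de.
have E2 := weak_deriv_bump (fun=> 0%N) rho0 CG ug.
rewrite kbg in E1.
rewrite (_ : (fun i => 0 + gamma i)%N = gamma) in E2; last by apply/funext.
have iP : mu.-integrable (cube c rho) (EFin \o P).
  rewrite (_ : P = u \- e); last by apply/funext => x; rewrite /e /= subKr.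
  rewrite (_ : EFin \o _ = (EFin \o u) \- (EFin \o e))%E; last by apply/funext.
  by apply: integrableB => //; [exact: iu | exact: ie].
(* The polynomial is invisible to the [gamma]-derivative of the bump. Both sides are then integrated
   by parts: all of [gamma] is moved onto [u], but only [beta] onto the error [e], leaving
   [gamma - beta] on the bump. *)
have E3 : \int[mu]_(x in cube c rho) (e x * bump c rho gamma x) =
    \int[mu]_(x in cube c rho) (u x * bump c rho gamma x).
  under eq_Rintegral do rewrite /e mulrBl.
  rewrite RintegralB//; [|by apply: integrable_mul_bump => //;
    exact: iu|exact: integrable_mul_bump].
  by rewrite (integral_poly_bump rho0 Pp DP) subr0.
have Xd : `|\int[mu]_(x in cube c rho) (g x * bump c rho (fun=> 0%N) x)| =
    `|\int[mu]_(x in cube c rho) (d x * bump c rho k x)|.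
  have := congr1 Num.norm E2; rewrite -E3 E1 !normrM !normrX !normrN1 !expr1n !mul1r.
  by move=> ->.
rewrite Xd.
have id0 : mu.-integrable (cube c rho) (EFin \o d) by exact: id_.
have idb := integrable_mul_bump k rho0 id0.
apply: (@le_trans _ _ ((M * rho ^- (r - j))%:E *
    \int[mu]_(x in cube c rho) `|(d x)%:E|)%E).
  rewrite EFin_normr_Rintegral//.
  apply: (le_trans (le_abse_integral _ mC (measurable_int _ idb))).
  rewrite -ge0_integralZl//; last 2 first.
  - by apply: measurableT_comp => //; exact: measurable_int id0.
  - by rewrite lee_fin mulr_ge0 ?invr_ge0 ?exprn_ge0 ?ltW.
  apply: ge0_le_integral => //.
  - by apply: measurableT_comp => //; exact: measurable_int idb.
  - apply: measurable_funeM; apply: measurableT_comp => //; exact: measurable_int id0.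
  - move=> x _; rewrite -EFinM lee_fin normrM mulrC ler_wpM2r// -mk HM// => i.
    by rewrite -gr /mlen (bigD1 i)//= (leq_trans (leq_subr _ _)) ?leq_addr.
rewrite [X in (_ <= X * _)%E]EFinM -muleA lee_wpmul2l//.
  by rewrite lee_fin mulr_ge0 ?invr_ge0 ?exprn_ge0 ?ltW.
have muC := @lebesgue_cube R n c rho (ltW rho0).
have C0 : (0 < mu (cube c rho))%E by rewrite muC lte_fin exprn_gt0// mulr_gt0.
have Coo : (mu (cube c rho) < +oo)%E by rewrite muC ltry.
rewrite (_ : (2 * rho) ^+ n = fine (mu (cube c rho))); last by rewrite muC.
exact: integral_le_Lnorm.
Qed.

End local_estimate.

Section scaled_local_estimate.
Context {R : realType} {n : nat}.
Implicit Types (c x : 'rV[R]_n) (h : R) (D G : set 'rV[R]_n)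
  (u g P : 'rV[R]_n -> R) (gamma : 'I_n -> nat).
Local Notation mu := (lebesgue_rV R n).

(** [bump_duality] with [rho = kappa h], raised to the power [p]. It carries the power
    [j - r + n (1 - 1/q)] of [h]; multiplying by [h^(- n (1 - 1/p))] turns this into the weight of
    the statement, while on the left [(X h^(- n (1 - 1/p)))^p = h^n (X / h^n)^p], a volume times the
    [p]-th power of an average. *)
Lemma local_lower_bound (r j : nat) (q : \bar R) (p kappa : R) :
  (j <= r)%N -> (1 <= q)%E -> 1 <= p -> 0 < kappa ->
  exists2 A : R, 0 < A & forall D G u g P gamma (r' : nat) c h,
    0 < h -> measurable D -> cube c (kappa * h) `<=` D -> D `<=` G ->
    is_weak_deriv G gamma u g -> mlen gamma = r -> poly_fun r' P ->
    (forall x, cube c (kappa * h) x -> pderiv gamma P x = 0) ->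
  ((A * (h ^+ n *
     (`|\int[mu]_(x in cube c (kappa * h)) (g x * bump c (kappa * h) (fun=> 0%N) x)| /
        h ^+ n) `^ p))%:E <=
   (h `^ (p * (j%:R - r%:R + n%:R * (p^-1 - fine (q^-1)%E))))%:E *
     sobolev_norm j q D (fun x => u x - P x)%R `^ p)%E.
Proof.
move=> jr q1 p1 kappa0; have [M M0 HM] := @bump_duality R n r j jr.
have p0 : 0 < p := lt_le_trans ltr01 p1.
set a := 1 - fine (q^-1)%E in HM.
(* [B] is what remains of the duality constant once all powers of [h] are taken out. *)
pose B := M * kappa ^- (r - j) * ((2 * kappa) ^+ n) `^ a.
have B0 : 0 < B.
  by rewrite !mulr_gt0 ?invr_gt0 ?exprn_gt0// powR_gt0// exprn_gt0// mulr_gt0.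
exists (B^-1 `^ p); first by rewrite powR_gt0// invr_gt0.
move=> D G u g P gamma r' c h h0 mD CD DG ug gr Pp DP.
have rho0 : 0 < kappa * h by rewrite mulr_gt0.
have := HM q D G u g P gamma r' c _ q1 rho0 mD CD DG ug gr Pp DP.
set X := `|_|; set N := sobolev_norm _ _ _ _ => XN.
have X0 : 0 <= X by rewrite normr_ge0.
have N0 : (0 <= N)%E.
  rewrite /N /sobolev_norm; case: ifPn => // _;
    case: q {q1 HM XN B B0 N} @a => [q| |] a.
  - exact: poweR_ge0.
  - by apply: bigmax_ge_id.
  - by apply: bigmax_ge_id.
pose e := - (n%:R * (1 - p^-1)).
pose s := h `^ (j%:R - r%:R + n%:R * (p^-1 - fine (q^-1)%E)).
have hn t : (h ^+ n) `^ t = h `^ (n%:R * t) by rewrite -powR_mulrn ?ltW// -powRrM.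
have h1 t : 0 < h `^ t by exact: powR_gt0.
have hN0 : h != 0 by rewrite gt_eqF.
have sE : s = (M * (kappa * h) ^- (r - j) * ((2 * (kappa * h)) ^+ n) `^ a) * (B^-1 *
  h `^ e).
  have -> : (kappa * h) ^- (r - j) = kappa ^- (r - j) * h `^ (j%:R - r%:R).
    by rewrite exprMn invfM; congr (_ * _); rewrite -powR_invn ?ltW// natrB// opprB.
  rewrite mulrA exprMn powRM ?exprn_ge0 ?mulr_ge0 ?ltW// hn /s.
  transitivity (B * B^-1 * (h `^ (j%:R - r%:R) * h `^ (n%:R * a) * h `^ e));
    last by rewrite /B; ring.
  rewrite divff ?gt_eqF// mul1r -!powRD; [|by rewrite hN0 implybT..].
  by congr (h `^ _); rewrite /a /e; ring.
have le1 : ((B^-1 * X * h `^ e)%:E <= s%:E * N)%E.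
  have e0 : (0 <= (B^-1 * h `^ e)%:E)%E by rewrite lee_fin mulr_ge0 ?invr_ge0 ?ltW.
  have := lee_wpmul2l e0 XN; rewrite muleA -!EFinM.
  by rewrite [X in (_ <= X%:E * _)%E]mulrC -sE mulrAC.
clearbody B; have E1 : B^-1 `^ p * (h ^+ n * (X / h ^+ n) `^ p) = (B^-1 * X * h `^
  e) `^ p.
  have B1 : 0 <= B^-1 by rewrite invr_ge0 ltW.
  have hn1 : 0 <= (h ^+ n)^-1 by rewrite invr_ge0 exprn_ge0// ltW.
  rewrite (powRM _ X0 hn1) (powRM _ (mulr_ge0 B1 X0) (powR_ge0 _ _)) (powRM _ B1 X0).
  rewrite -mulrA; congr (_ * _); rewrite mulrCA; congr (_ * _).
  rewrite -(@powR_mulrn _ h n (ltW h0)) -powRN -!powRrM -powRD ?hN0 ?implybT//.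
  by congr (h `^ _); rewrite /e; field; rewrite gt_eqF.
have -> : h `^ (p * (j%:R - r%:R + n%:R * (p^-1 - fine (q^-1)%E))) = s `^ p.
  by rewrite /s -powRrM mulrC.
rewrite E1 -!poweR_EFin -poweRM//; last by rewrite lee_fin /s powR_ge0.
apply: gt0_ler_poweR => //; first exact: ltW.
- by rewrite in_itv/= leey andbT lee_fin !mulr_ge0 ?invr_ge0// ltW.
- by rewrite in_itv/= leey andbT mule_ge0// lee_fin ltW.
Qed.

End scaled_local_estimate.

(** * Dyadic grid *)

Section dyadic_grid.
Context {R : realType} {n : nat}.
Implicit Types (x y : 'rV[R]_n) (A B U V : set 'rV[R]_n) (k l : nat).
Local Notation mu := (lebesgue_rV R n).

Definition grid k x : {ffun 'I_n -> int} :=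
  [ffun i => Num.floor (2 ^+ k * x ord0 i)].

Definition cell k x : set 'rV[R]_n := [set y | grid k y = grid k x].

Definition grid_set k U := forall x, U x -> cell k x `<=` U.

(** The grids are nested: the floor of [2 a] is [2 floor a] or [2 floor a + 1], so it determines the
    floor of [a]. *)
Lemma grid_succ k x y : grid k.+1 x = grid k.+1 y -> grid k x = grid k y.
Proof.
move=> /ffunP H; apply/ffunP => i; have := H i; rewrite !ffunE exprS -!mulrA.
set a := 2 ^+ k * _; set b := 2 ^+ k * _ => ab.
apply/esym/eqP; rewrite floor_eq; apply/andP.
have /andP[f1 f2] := floor_itv a.
have /andP[g1 g2] := floor_itv (2 * b).
have h1 : 2 * Num.floor a <= Num.floor (2 * a).
  by rewrite floor_ge_int intrM ler_pM2l.
have h2 : Num.floor (2 * a) + 1 <= 2 * (Num.floor a + 1).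
  rewrite lezD1 floor_lt_int intrM ltr_pM2l//.
move: h1 h2; rewrite -!(ler_int R) ab !intrM !intrD => h1 h2.
split.
  by rewrite -(ler_pM2l (@ltr0Sn R 1)); apply: le_trans g1; exact: h1.
rewrite -(ltr_pM2l (@ltr0Sn R 1)); apply: lt_le_trans h2.
by move: g2; rewrite intrD.
Qed.

Lemma grid_set_le k l U : (k <= l)%N -> grid_set k U -> grid_set l U.
Proof.
move=> kl sU x Ux y yx; apply: (sU x) => //; rewrite /cell/= in yx *.
elim: l kl yx => [|l IH]; first by rewrite leqn0 => /eqP ->.
rewrite leq_eqVlt => /predU1P[->//|kl] yx; apply: IH => //; exact: grid_succ.
Qed.

Lemma grid_setC k U : grid_set k U -> grid_set k (~` U).
Proof. by move=> sU x nUx y yx Uy; apply: nUx; apply: (sU y). Qed.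

Lemma grid_setU k U V : grid_set k U -> grid_set k V -> grid_set k (U `|` V).
Proof.
by move=> sU sV x [Ux|Vx] y yx; [left; exact: (sU x)|right; exact: (sV x)].
Qed.

Lemma grid_set_cell k x : grid_set k (cell k x).
Proof. by move=> y yx z zy; rewrite /cell/= in yx zy *; rewrite zy. Qed.

Lemma cellE k x : cell k x = rbox (fun i =>
  `[(grid k x i)%:~R / 2 ^+ k, (grid k x i + 1)%:~R / 2 ^+ k[%classic).
Proof.
have p2 : 0 < 2 ^+ k :> R by rewrite exprn_gt0.
apply/seteqP; split => y.
  move=> yx i; rewrite /= in_itv/= -yx ffunE ler_pdivrMr// ltr_pdivlMr//.
  by rewrite [_ * 2 ^+ k]mulrC floor_itv.
move=> H; apply/ffunP => i; have := H i.
rewrite /= in_itv/= ler_pdivrMr// ltr_pdivlMr// [_ * 2 ^+ k]mulrC => h.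
by rewrite [LHS]ffunE; apply: floor_def.
Qed.

Lemma measurable_cell k x : measurable (cell k x).
Proof. by rewrite cellE; apply: measurable_rbox => i; exact: measurable_itv. Qed.

Lemma lebesgue_cell k x : mu (cell k x) = ((2 ^- k) ^+ n)%:E.
Proof.
have p2 : 0 < 2 ^+ k :> R by rewrite exprn_gt0.
have E i : lebesgue_measure
    `[(grid k x i)%:~R / 2 ^+ k, (grid k x i + 1)%:~R / 2 ^+ k[%classic = (2 ^-
      k)%:E :> \bar R.
  rewrite lebesgue_measure_itv/= lte_fin ltr_pM2r ?invr_gt0// ltr_int ltrDl ltr01.
  by rewrite -EFinB -mulrBl intrD addrAC subrr add0r mul1r.
rewrite cellE lebesgue_rbox => [|i|i]; [|exact: measurable_itv|by rewrite E ltry].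
by under eq_bigr do rewrite E/=; rewrite prodr_const card_ord.
Qed.

Lemma grid_set_bigcup k U : grid_set k U -> exists F : nat -> set 'rV[R]_n,
  [/\ forall j, F j = set0 \/ exists2 x, U x & F j = cell k x,
      trivIset setT F & U = \bigcup_j F j].
Proof.
(* Integer vectors are countable; a code of no vector, or of a cell outside [U], yields the empty
   set. *)
move=> sU; exists (fun j => if @pickle_inv {ffun 'I_n -> int} j is Some z then
  U `&` [set y | grid k y = z] else set0); split.
- move=> j; case: pickle_inv => [z|]; last by left.
  have [[x [Ux xz]]|H] := pselect (exists x, U x /\ grid k x = z).
    right; exists x => //; apply/seteqP; split => y; first by move=> [_ /= yz];
      rewrite /cell/= yz xz.
    by move=> yx; split; [exact: (sU x)|rewrite /= yx].
  left; apply/seteqP; split => y // -[Uy yz]; by apply: H; exists y.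
- apply/trivIsetP => i j _ _ ij; apply/seteqP; split => x //.
  case Ei: pickle_inv => [z|]; last by case.
  case Ej: pickle_inv => [z'|]; last by case.
  move=> [[_ /= xz] [_ /= xz']]; move/eqP: ij; apply.
  have := @pickle_invK {ffun 'I_n -> int} i; rewrite Ei/= => <-.
  have := @pickle_invK {ffun 'I_n -> int} j; rewrite Ej/= => <-.
  by rewrite -xz -xz'.
- apply/seteqP; split => x.
    by move=> Ux; exists (pickle (grid k x)) => //; rewrite pickleK_inv.
  by move=> [j _]; case: pickle_inv => [z []|].
Qed.

End dyadic_grid.

(** * Approximation of measurable sets by unions of dyadic cells *)

Section dyadic_approximation.
Context {R : realType} {n : nat}.
Implicit Types (x y : 'rV[R]_n) (A B U V : set 'rV[R]_n) (k l : nat).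
Local Notation mu := (lebesgue_rV R n).

Lemma measurable_grid_set k U : grid_set k U -> measurable U.
Proof.
move=> /grid_set_bigcup[F [HF _ ->]]; apply: bigcup_measurable => j _.
by have [->//|[x _ ->]] := HF j; exact: measurable_cell.
Qed.

Lemma exists_exp2V_lt (e : R) : 0 < e -> exists k, 2 ^- k < e.
Proof.
move=> e0; exists (Num.truncn e^-1).+1.
rewrite invf_plt ?posrE ?exprn_gt0//; apply: lt_le_trans (truncnS_gt _) _.
by rewrite -natrX ler_nat ltnW// ltn_expl.
Qed.

Lemma sub_cell_cube k x : cell k x `<=` cube x (2 ^- k).
Proof.
move=> y yx; apply/cubeP => i.
have p2 : 0 < 2 ^+ k :> R by rewrite exprn_gt0.
have := yx; rewrite /cell/= => /ffunP /(_ i); rewrite !ffunE => E.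
have /andP[a1 a2] := floor_itv (2 ^+ k * y ord0 i).
have /andP[b1 b2] := floor_itv (2 ^+ k * x ord0 i).
rewrite E in a1 a2; rewrite intrD in a2 b2.
rewrite -(ler_pM2l p2) divff ?gt_eqF// -[X in X * _]gtr0_norm// -normrM mulrBr.
by rewrite ler_norml; apply/andP; split; lra.
Qed.

Lemma mx_norm_le_cube x y (e : R) : 0 < e -> cube x e y -> `|x - y| <= e.
Proof.
move=> e0 /cubeP xy; rewrite [leLHS]mx_normrE; apply: bigmax_le; first exact: ltW.
by move=> [i j] _; rewrite (ord1 i) !mxE/= distrC.
Qed.

Lemma open_sub_cube U x : open U -> U x -> exists k, cube x (2 ^- k) `<=` U.
Proof.
move=> oU Ux; have := open_nbhs_nbhs (conj oU Ux) => /nbhs_ballP[e /= e0 eU].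
have [k ke] := exists_exp2V_lt e0; exists k => y xy; apply: eU.
rewrite -ball_normE/=; apply: le_lt_trans ke.
by apply: mx_norm_le_cube => //; rewrite invr_gt0 exprn_gt0.
Qed.

Lemma open_bigcup_cells U : open U ->
  exists V : nat -> set 'rV[R]_n, (forall k, grid_set k (V k)) /\ U = \bigcup_k V k.
Proof.
move=> oU; exists (fun k => [set x | cell k x `<=` U]); split.
  by move=> k x xU y yx z zy; apply: xU; rewrite /cell/= in yx zy *; rewrite zy.
apply/seteqP; split => x.
  move=> Ux; have [k kU] := open_sub_cube oU Ux; exists k => //=.
  exact: subset_trans (@sub_cell_cube k x) kU.
by move=> [k _ /= kU]; exact: kU.
Qed.

(** The sigma-algebra is generated by the coordinates, not by the topology; the dyadic decomposition
    links the two. *)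
Lemma open_measurable_rV U : open U -> measurable U.
Proof.
move=> /open_bigcup_cells[V [sV ->]]; apply: bigcup_measurable => k _.
exact: measurable_grid_set (sV k).
Qed.

Variable Q : set 'rV[R]_n.
Hypotheses (mQ : measurable Q) (Qoo : (mu Q < +oo)%E).

Definition symdiff A B := (A `\` B) `|` (B `\` A).

(** The error is measured inside [Q], whose finite measure lets a countable union be approximated by
    finite ones. *)
Definition dyadic_approx A := measurable A /\ forall e : R, 0 < e ->
  exists k U, grid_set k U /\ (mu (symdiff A U `&` Q) < e%:E)%E.

Lemma measurable_symdiff A B : measurable A -> measurable B ->
  measurable (symdiff A B `&` Q).
Proof. by move=> mA mB; apply: measurableI => //; apply: measurableU;
  exact: measurableD. Qed.

Lemma dyadic_approx_grid_set k U : grid_set k U -> dyadic_approx U.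
Proof.
move=> sU; split; first exact: measurable_grid_set sU.
by move=> e e0; exists k, U; split => //;
  rewrite /symdiff setDv setU0 set0I measure0 lte_fin.
Qed.

Lemma dyadic_approxC A : dyadic_approx A -> dyadic_approx (~` A).
Proof.
move=> [mA HA]; split=> [|e /HA[k [U [sU AU]]]]; first exact: measurableC.
exists k, (~` U); split; first exact: grid_setC.
rewrite (_ : symdiff _ _ = symdiff A U)// /symdiff !setDE !setCK setUC.
by rewrite [~` U `&` _]setIC [~` A `&` _]setIC.
Qed.

Lemma dyadic_approxU A B : dyadic_approx A -> dyadic_approx B ->
  dyadic_approx (A `|` B).
Proof.
move=> [mA HA] [mB HB]; split=> [|e e0]; first exact: measurableU.
have e2 : 0 < e / 2 by rewrite divr_gt0.
have [k [U [sU AU]]] := HA _ e2; have [l [V [sV BV]]] := HB _ e2.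
exists (maxn k l), (U `|` V); split.
  by apply: grid_setU; [apply: (grid_set_le _ sU)|apply: (grid_set_le _ sV)];
    rewrite ?leq_maxl ?leq_maxr.
have mU := measurable_grid_set sU; have mV := measurable_grid_set sV.
rewrite [e]splitr EFinD; apply: le_lt_trans (lteD AU BV).
apply: le_trans (measureU2 _ (measurable_symdiff mA mU) (measurable_symdiff mB mV)).
apply: le_measure; rewrite ?inE.
- by apply: measurable_symdiff; exact: measurableU.
- by apply: measurableU; exact: measurable_symdiff.
- move=> x [[[[Ax|Bx] /not_orP[nU nV]]|[[Ux|Vx] /not_orP[nA nB]]] Qx];
    [left|right|left|right]; split => //; by [left|right].
Qed.

(** Half of [e] pays for truncating the union at some [H N], by continuity of the measure from
    below; the other half pays for approximating [H N]. A single grid level then suffices. *)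
Lemma dyadic_approx_bigcup (F : nat -> set 'rV[R]_n) :
  (forall j, dyadic_approx (F j)) -> dyadic_approx (\bigcup_j F j).
Proof.
move=> HF; have mF j : measurable (F j) by have [] := HF j.
have mUF : measurable (\bigcup_j F j) by exact: bigcup_measurable.
split => // e e0; have e2 : 0 < e / 2 by rewrite divr_gt0.
pose H j := \bigcup_(i < j) F i.
have HH j : dyadic_approx (H j).
  rewrite /H; elim: j => [|j IH].
    by rewrite bigcup_mkord big_ord0; apply: (@dyadic_approx_grid_set 0).
  by rewrite bigcup_mkord big_ord_recr/= -bigcup_mkord; exact: dyadic_approxU.
have mH j : measurable (H j) by have [] := HH j.
have HE : \bigcup_j F j `&` Q = \bigcup_j (H j `&` Q).
  apply/seteqP; split => x.
    by move=> [[j _ Fx] Qx]; exists j.+1 => //; split => //; exists j => /=.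
  by move=> [j _ [[i _ Fx] Qx]]; split => //; exists i.
have mHQ j : measurable (H j `&` Q) by exact: measurableI.
have mUH : measurable (\bigcup_j (H j `&` Q)) by exact: bigcup_measurable.
have fUH : mu (\bigcup_j F j `&` Q) \is a fin_num.
  rewrite ge0_fin_numE//; apply: le_lt_trans Qoo; apply: le_measure; rewrite ?inE//.
  exact: measurableI.
have := @nondecreasing_cvg_mu _ _ _ mu _ mHQ mUH.
have ndH : nondecreasing_seq (fun j => H j `&` Q).
  move=> i j ij; apply/subsetPset => x [[l /= li Fx] Qx]; split => //.
  by exists l => //=; exact: leq_trans ij.
move=> /(_ ndH); rewrite -HE => cvH.
have [N HN] : exists N, (mu ((\bigcup_j F j `\` H N) `&` Q) < (e / 2)%:E)%E.
  have : mu (H j `&` Q) @[j --> \oo] --> (fine (mu (\bigcup_j F j `&` Q)))%:E.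
    by rewrite fineK.
  move=> /fine_cvgP[_ /cvgrPdist_lt /(_ _ e2)].
  case=> N _ /(_ N (leqnn N)) /= HN; exists N.
  rewrite (_ : _ `&` Q = (\bigcup_j F j `&` Q) `\` (H N `&` Q)); last first.
    apply/seteqP; split => x; first by move=> [[Fx nH] Qx]; split => // -[].
    by move=> [[Fx Qx] nH]; split => //; split => // Hx; exact: nH.
  have HNF : H N `&` Q `<=` \bigcup_j F j `&` Q.
    by move=> x [[i _ Fx] Qx]; split => //; exists i.
  have fH : mu (H N `&` Q) \is a fin_num.
    rewrite ge0_fin_numE//; apply: le_lt_trans Qoo; apply: le_measure; rewrite ?inE//.
  have -> : (mu ((\bigcup_j F j `&` Q) `\` (H N `&` Q)) =
      mu (\bigcup_j F j `&` Q) - mu (H N `&` Q))%E.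
    rewrite measureD//; [by rewrite (setIidr HNF)|exact: measurableI|].
    by rewrite -ge0_fin_numE.
  rewrite -(fineK fUH) -(fineK fH) -EFinB lte_fin.
  exact: le_lt_trans (ler_norm _) HN.
have [k [U [sU UH]]] := (HH N).2 _ e2; have mU := measurable_grid_set sU.
exists k, U; split => //; rewrite [e]splitr EFinD; apply: le_lt_trans (lteD HN UH).
have mD : measurable ((\bigcup_j F j `\` H N) `&` Q).
  by apply: measurableI => //; exact: measurableD.
apply: le_trans (measureU2 _ mD (measurable_symdiff (mH N) mU)).
apply: le_measure; rewrite ?inE.
- exact: measurable_symdiff.
- by apply: measurableU => //; exact: measurable_symdiff.
- move=> x [[[Fx nU]|[Ux nF]] Qx].
    by have [Hx|nHx] := pselect (H N x); [right; split => //; left|left].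
  right; split => //; right; split => // -[i _ Fx]; apply: nF; by exists i.
Qed.

Lemma measurable_dyadic_approx A : measurable A -> dyadic_approx A.
Proof.
have sig : sigma_algebra setT dyadic_approx.
  split; first exact: (@dyadic_approx_grid_set 0).
    by move=> B HB; rewrite setTD; exact: dyadic_approxC.
  exact: dyadic_approx_bigcup.
apply: smallest_sub => // B; rewrite -bigcup_seq => -[i _ [C mC <-]]; rewrite setTI.
have {}mC : (@RGenInftyO.G R).-sigma.-measurable C by rewrite -RGenInftyO.measurableE.
move: C mC.
suff: [set C | (@RGenInftyO.G R).-sigma.-measurable C] `<=` [set C | dyadic_approx
  (rV_coord i @^-1` C)].
  by move=> H C mC; exact: H.
apply: smallest_sub.
  split; first by rewrite /mkset preimage_set0; case: sig.
    move=> C HC; rewrite /mkset setTD preimage_setC.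
    exact: dyadic_approxC.
  by move=> C HC; rewrite /mkset preimage_bigcup; exact: dyadic_approx_bigcup.
move=> _ [a ->] /=.
(* An open half-space is the union over [k] of the grid sets obtained by rounding its bound [a] down
   to a multiple of [2 ^- k]. *)
rewrite (_ : _ @^-1` _ =
    \bigcup_k [set x : 'rV[R]_n | 2 ^+ k * x ord0 i < (Num.floor (2 ^+ k * a))%:~R]).
  apply: dyadic_approx_bigcup => k; apply: (@dyadic_approx_grid_set k).
  move=> x /= xa y /ffunP/(_ i); rewrite !ffunE => yx.
  by rewrite /= -floor_lt_int yx floor_lt_int.
apply/seteqP; split => x; rewrite /preimage/= in_itv/= /rV_coord.
  move=> xa; have [k Hk] : exists k, 2 ^- k < a - x ord0 i.
    by apply: exists_exp2V_lt; rewrite subr_gt0.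
  exists k => //=; have p2 : 0 < 2 ^+ k :> R by rewrite exprn_gt0.
  have := floorD1_gt (2 ^+ k * a); rewrite intrD.
  by move: Hk; rewrite invf_plt ?posrE ?subr_gt0// -div1r ltr_pdivrMr ?subr_gt0//;
    lra.
move=> [k _ /=] h; have p2 : 0 < 2 ^+ k :> R by rewrite exprn_gt0.
by rewrite -(ltr_pM2l p2); apply: lt_le_trans h (floor_le _).
Qed.

End dyadic_approximation.

(** * Cubes of almost constancy *)

Lemma measure_gt0_bigcup d (T : measurableType d) (R : realType)
    (nu : {measure set T -> \bar R}) (N : set T) (F : nat -> set T) :
  measurable N -> (forall j, measurable (F j)) -> N `<=` \bigcup_j F j ->
  (0 < nu N)%E -> exists j, (0 < nu (F j `&` N))%E.
Proof.
move=> mN mF NF N0; apply/not_existsP => H.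
have : nu.-negligible N.
  apply: (@negligibleS _ _ _ _ (\bigcup_j (F j `&` N))).
    by move=> x Nx; have [j _ Fx] := NF _ Nx; exists j.
  apply: negligible_bigcup => j; apply/negligibleP; first exact: measurableI.
  by apply/eqP; rewrite eq_le measure_ge0 andbT leNgt; apply/negP; exact: H.
by move=> /(negligibleP _ mN) N00; rewrite N00 ltxx in N0.
Qed.

Lemma measurable_neq0 d (T : measurableType d) (R : realType) (G : set T)
    (g : T -> R) : measurable G -> measurable_fun G g ->
  measurable (G `&` [set x | g x != 0]).
Proof.
move=> mG mg; rewrite (_ : _ `&` _ = G `&` g @^-1` (~` [set 0])).
  by apply: mg => //; apply: measurableC; exact: measurable_set1.
by apply/seteqP; split => x [Gx /eqP gx]; split => //; exact/eqP.
Qed.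

Lemma integrable_subr_cst d (T : measurableType d) (R : realType)
    (nu : {measure set T -> \bar R}) (D : set T) (g : T -> R) (a : R) :
  measurable D -> (nu D < +oo)%E -> nu.-integrable D (EFin \o g) ->
  nu.-integrable D (EFin \o (fun x => g x - a)).
Proof.
move=> mD Doo ig.
rewrite (_ : EFin \o _ = (EFin \o g) \- (EFin \o cst a))%E; last exact/funext.
by apply: integrableB => //; apply: measurable_bounded_integrable => //;
  exact: bounded_cst.
Qed.

Section good_cube.
Context {R : realType} {n : nat}.
Implicit Types (x y : 'rV[R]_n) (A B U V G : set 'rV[R]_n) (k l : nat)
  (g : 'rV[R]_n -> R).
Local Notation mu := (lebesgue_rV R n).

Lemma Lp_norm_gt0 G p g : measurable G -> measurable_fun G g -> 0 < p ->
  (0 < Lp_norm G p%:E g)%E -> (0 < mu (G `&` [set x | g x != 0%R]))%E.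
Proof.
move=> mG mg p0; apply: contraTT; rewrite -!leNgt => N0.
set N := G `&` _ in N0.
have mN : measurable N := measurable_neq0 mG mg.
have muN : mu N = 0%E by apply/eqP; rewrite eq_le N0 measure_ge0.
rewrite /Lp_norm unlock.
rewrite (_ : (\int[mu]_x _)%E = 0%E) ?poweR0r// ?invr_neq0 ?gt_eqF//.
rewrite (_ : (fun x => _) = (fun x => (`|g x| `^ p)%:E) \_ N).
  rewrite -integral_mkcond null_set_integral//.
  apply/measurable_EFinP; apply: (measurableT_comp (measurable_powR p)).
  apply: measurableT_comp => //; apply: measurable_funS mg => //.
  by move=> x [].
apply/funext => x; rewrite patchE; case: ifPn => [|/negP]; rewrite inE.
  by move=> [Gx _]; rewrite indicE mem_set//= mul1r.
move=> nNx; suff -> : \1_G x * g x = 0 by rewrite /= normr0 powR0 ?gt_eqF.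
rewrite indicE; have [Gx|nGx] := pselect (G x); last by rewrite memNset// mul0r.
by rewrite mem_set// mul1r; apply/eqP/negPn/negP => gx; exact: nNx.
Qed.

(** A Lebesgue-point argument without differentiation of measures. A pigeonhole over the rationals
    finds [a != 0] to which [g] is close on a set [A] of positive measure; [A] is then nearly a
    union of cells, and one of these must be good. *)
Lemma good_cell G g (eps : R) : open G -> loc_integrable G g -> 0 < eps ->
  (0 < mu (G `&` [set x | g x != 0%R]))%E ->
  exists k x (a : R), [/\ a != 0, cell k x `<=` G,
    mu.-integrable (cell k x) (EFin \o g) &
    (\int[mu]_(y in cell k x) `|(g y - a)%:E| <= (eps * `|a|)%:E * mu (cell k x))%E].
Proof.
move=> oG [mg ig] eps0 N0; set N := G `&` _ in N0.
have mG := open_measurable_rV oG.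
have mN : measurable N := measurable_neq0 mG mg.
(* As [g] is only locally integrable, the cell must lie in a compact subset of [G], here a closed
   cube. Letting the centre be any point of the cell makes [W k] a grid set. *)
pose W k := [set x | exists2 y, cell k x y & cube y (2 ^- k) `<=` G].
have sW k : grid_set k (W k).
  by move=> x [y xy yG] z zx; exists y => //; rewrite /cell/= in xy zx *; rewrite xy.
have NW : N `<=` \bigcup_k W k.
  by move=> x [Gx _]; have [k kG] := open_sub_cube oG Gx; exists k => //; exists x.
have [k Wk0] := measure_gt0_bigcup mN (fun k => measurable_grid_set (sW k)) NW N0.
have mWN : measurable (W k `&` N).
  by apply: measurableI => //; exact: measurable_grid_set (sW k).
have [F [HF _ WF]] := grid_set_bigcup (sW k).
have mF j : measurable (F j).
  by have [->//|[x _ ->]] := HF j; exact: measurable_cell.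
have WNF : W k `&` N `<=` \bigcup_j F j by rewrite -WF => x [].
have [j Fj0] := measure_gt0_bigcup mWN mF WNF Wk0.
have [Fj|[x0 [y0 xy0 y0G] Fj]] := HF j.
  by move: Fj0; rewrite Fj set0I measure0 ltxx.
have {xy0 x0 Fj} Fj : F j = cell k y0.
  by rewrite Fj; apply/seteqP; split => z; rewrite /cell/= in xy0 *; rewrite xy0.
move: (F j) (mF j) Fj Fj0 => Q mQ Fj Fj0; have QG : Q `<=` G.
  by rewrite Fj; apply: subset_trans y0G; exact: sub_cell_cube.
have Qoo : (mu Q < +oo)%E by rewrite Fj lebesgue_cell ltry.
have iQ : mu.-integrable Q (EFin \o g).
  apply: (@integrableS _ _ _ mu (cube y0 (2 ^- k))) => //;
    first exact: measurable_cube.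
    by rewrite Fj; exact: sub_cell_cube.
  by apply: ig => //; exact: compact_cube.
have mgQ : measurable_fun Q g by exact: measurable_funS mg.
have sQ : grid_set k Q by rewrite Fj; exact: grid_set_cell.
have QN0 : (0 < mu (Q `&` N))%E.
  apply: lt_le_trans Fj0 _; apply: le_measure; rewrite ?inE.
  - by apply: measurableI.
  - by apply: measurableI.
  - by move=> x [Qx []].
pose E (a : R) := Q `&` [set x | `|g x - a| <= eps / 2 * `|a|].
have mE a : measurable (E a).
  rewrite (_ : E a = Q `&` (fun x => `|g x - a|) @^-1` `]-oo, eps / 2 * `|a|]);
    last first.
    by apply/seteqP; split => x; rewrite /E /= in_itv/=.
  have : measurable_fun Q (fun x => `|g x - a|).
    by apply: measurableT_comp => //; apply: measurable_funB.
  by apply => //; exact: measurable_itv.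
pose H j := if @pickle_inv rat j is Some a then
  (if a == 0 then set0 else E (ratr a)) else set0.
have mH i : measurable (H i).
  by rewrite /H; case: pickle_inv => // a; case: ifP.
have QNH : Q `&` N `<=` \bigcup_j H j.
  move=> x [Qx [_ /= gx]].
  (* The first bound forces the rational [a] to satisfy [|a| >= |g x| / 2 > 0]; with this, the
     second one is at most [eps / 2 * |a|]. *)
  pose eta := Num.min (`|g x| / 2) (eps * `|g x| / 4).
  have g0 : 0 < `|g x| by rewrite normr_gt0.
  have eta0 : 0 < eta by rewrite /eta lt_min !divr_gt0//= mulr_gt0.
  have [a] := @rat_in_itvoo R (g x - eta) (g x + eta) (ltac:(lra)).
  rewrite in_itv/= => /andP[a1 a2].
  have ga : `|g x - ratr a| < eta by rewrite ltr_norml; apply/andP; split; lra.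
  have [e1 e2] : eta <= `|g x| / 2 /\ eta <= eps * `|g x| / 4.
    by rewrite /eta !ge_min !lexx orbT.
  have a2' : `|g x| / 2 <= `|ratr a : R|.
    have := ler_normB (g x) (g x - ratr a); rewrite subKr.
    have := ler_normD (ratr a : R) (g x - ratr a); rewrite addrC subrK; lra.
  exists (pickle a); [exact: I|rewrite /H pickleK_inv].
  have -> : (a == 0) = false.
    apply/negbTE/negP => /eqP az; move: a2'; rewrite az rmorph0 normr0; lra.
  split => //=; apply: (le_trans (ltW ga)); apply: (le_trans e2).
  have := ler_wpM2l (ltW eps0) a2'; lra.
have [i Hi0] := measure_gt0_bigcup (measurableI _ _ mQ mN) mH QNH QN0.
have [a aN0 A0] : exists2 a : R, a != 0 & (0 < mu (E a))%E.
  move: Hi0; rewrite /H; case: pickle_inv => [b|];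
    last by rewrite set0I measure0 ltxx.
  case: ifPn => [_|b0 h]; first by rewrite set0I measure0 ltxx.
  exists (ratr b); first by rewrite fmorph_eq0.
  apply: lt_le_trans h _; apply: le_measure; rewrite ?inE//.
  by apply: measurableI => //; exact: measurableI.
set A := E a in A0.
have mA : measurable A by exact: mE.
have AQ : A `<=` Q by move=> x [].
have fin_sub B : measurable B -> B `<=` Q -> mu B \is a fin_num.
  move=> mB BQ; rewrite ge0_fin_numE//; apply: le_lt_trans Qoo.
  by apply: le_measure; rewrite ?inE.
have fA := fin_sub _ mA AQ.
pose al := fine (mu A); have al0 : 0 < al.
  by rewrite fine_gt0// A0/= -ge0_fin_numE.
have an0 : 0 < `|a| by rewrite normr_gt0.
have iga : mu.-integrable Q (EFin \o (fun x => g x - a)).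
  exact: integrable_subr_cst.
have igaT : mu.-integrable setT (EFin \o ((fun x => g x - a) \_ Q)).
  by rewrite -restrict_EFin; apply/integrable_restrict => //; rewrite setTI.
have e0 : 0 < eps * `|a| * al / 4 by rewrite divr_gt0// !mulr_gt0.
have [del [del0 Hdel]] := integral_normr_continuous igaT e0.
(* [del], from absolute continuity of the integral, controls [|g - a|] on the part of [U'] outside
   [A]; [al / 2] ensures that [U'] keeps more than half of the measure of [A]. *)
have d0 : 0 < Num.min del (al / 2) by rewrite lt_min del0/= divr_gt0.
have [l [U [sU AU]]] := (measurable_dyadic_approx mQ Qoo mA).2 _ d0.
pose L := maxn k l; pose U' := U `&` Q.
have sU' : grid_set L U'.
  move=> x [Ux Qx] y yx; split.
    by apply: (grid_set_le _ sU Ux yx); rewrite leq_maxr.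
  by apply: (grid_set_le _ sQ Qx yx); rewrite leq_maxl.
have mU' := measurable_grid_set sU'.
have U'Q : U' `<=` Q by move=> x [].
have mS := measurable_symdiff mQ mA (measurable_grid_set sU).
(* If every cell of [U'] were bad, summing over the cells would make the mean of
   [|g - a|] over [U'] exceed [eps |a|], while [U'] almost coincides with [A],
   where [|g - a| <= eps / 2 |a|]. *)
apply/not_existsP => /(_ L) bad.
have {}bad x : U' x -> ((eps * `|a|)%:E * mu (cell L x) <=
    \int[mu]_(y in cell L x) `|(g y - a)%:E|)%E.
  move=> Ux; rewrite leNgt; apply/negP => lt; apply: bad; exists x, a.
  have cQ : cell L x `<=` Q by apply: subset_trans U'Q; exact: sU'.
  split => //; [exact: subset_trans QG| |exact: ltW].
  by apply: integrableS iQ => //; exact: measurable_cell.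
have mabs B : measurable B -> B `<=` Q -> measurable_fun B (fun y =>
  `|(g y - a)%:E|)%E.
  move=> mB BQ; apply: measurableT_comp => //.
  by apply: measurable_funS BQ _ => //; exact: measurable_int iga.
have low : ((eps * `|a|)%:E * mu U' <= \int[mu]_(y in U') `|(g y - a)%:E|)%E.
  have [F' [HF' tF' UF]] := grid_set_bigcup sU'.
  have mF' j' : measurable (F' j').
    by have [->//|[x _ ->]] := HF' j'; exact: measurable_cell.
  rewrite [in leRHS]UF ge0_integral_bigcup//; last by rewrite -UF; exact: mabs.
  rewrite [in leLHS]UF measure_semi_bigcup//; last by rewrite -UF.
  rewrite -nneseriesZl//.
  apply: lee_nneseries => [j' _ _|j' _].
    by rewrite mule_ge0// lee_fin mulr_ge0// ltW.
  have [->|[x Ux ->]] := HF' j'; last exact: bad.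
  by rewrite measure0 mule0 integral_set0.
have up1 : (\int[mu]_(y in U' `&` A) `|(g y - a)%:E| <= (eps / 2 * `|a|)%:E * mu
  U')%E.
  apply: (@le_trans _ _ ((eps / 2 * `|a|)%:E * mu (U' `&` A))%E).
    rewrite -integral_cst; last exact: measurableI.
    apply: ge0_le_integral => //; first exact: measurableI.
    - by apply: mabs; [exact: measurableI|move=> x [/U'Q]].
    - by move=> x [_ [_ /= h]]; rewrite lee_fin.
  rewrite lee_wpmul2l//; first by rewrite lee_fin mulr_ge0// divr_ge0// ltW.
  by apply: le_measure; rewrite ?inE//; exact: measurableI.
have up2 : (\int[mu]_(y in U' `\` A) `|(g y - a)%:E| <= (eps * `|a| * al / 4)%:E)%E.
  have mD : measurable (U' `\` A) by exact: measurableD.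
  have DQ : U' `\` A `<=` Q by move=> x [/U'Q].
  have muD : (mu (U' `\` A) < del%:E)%E.
    apply: (@le_lt_trans _ _ (mu (symdiff A U `&` Q))).
      apply: le_measure; rewrite ?inE//.
      by move=> x [[Ux Qx] nA]; split => //; right.
    by apply: lt_le_trans AU _; rewrite lee_fin ge_min lexx.
  have := Hdel _ mD muD; rewrite -lte_fin => /ltW; apply: le_trans.
  have iD : mu.-integrable (U' `\` A)
      (EFin \o (Num.norm \o ((fun x => g x - a) \_ Q))).
    by apply/integrable_norm; apply: integrableS igaT.
  rewrite /Rintegral fineK; last exact: (integrable_fin_num mD iD).
  rewrite le_eqVlt; apply/orP; left; apply/eqP; apply: eq_integral => y.
  by rewrite inE => Dy; rewrite /= patchE mem_set//; exact: DQ.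
have fU := fin_sub _ mU' U'Q.
pose v := fine (mu U').
have v_lb : al < v + al / 2.
  rewrite -lte_fin EFinD /al /v !fineK//.
  apply: (@le_lt_trans _ _ (mu U' + mu (symdiff A U `&` Q))%E).
    apply: le_trans (measureU2 _ mU' mS); apply: le_measure; rewrite ?inE//.
      exact: measurableU.
    move=> x Ax; have [Ux|nUx] := pselect (U x); first by left; split => //;
      exact: AQ.
    by right; split; [left|exact: AQ].
  rewrite lteD2lE//; apply: lt_le_trans AU _.
  by rewrite lee_fin ge_min lexx orbT.
have split_int : (\int[mu]_(y in U') `|(g y - a)%:E| =
    \int[mu]_(y in U' `&` A) `|(g y - a)%:E| + \int[mu]_(y in U' `\` A) `|(g y -
      a)%:E|)%E.
  rewrite -[in LHS](setUIDK U' A) ge0_integral_setU//.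
  - exact: measurableI.
  - exact: measurableD.
  - by rewrite setUIDK; exact: mabs.
  - by apply/disj_setPS => x [[_ Ax] [_ nAx]].
(* After division by [eps * |a|] this reads [v <= v / 2 + al / 4], that is [v <= al / 2], against
   [v_lb]. *)
have := le_trans low _; rewrite split_int => /(_ _ (leeD up1 up2)).
rewrite -(fineK fU) -/v -!EFinM -EFinD lee_fin.
have : 0 < eps * `|a| by rewrite mulr_gt0.
have -> : eps / 2 * `|a| * v = eps * `|a| * (v / 2) by ring.
have -> : eps * `|a| * al / 4 = eps * `|a| * (al / 4) by ring.
move=> ea0; rewrite -mulrDr ler_pM2l//; lra.
Qed.

(** A closed concentric cube with half the side fits into the half-open cell. Its volume is smaller
    by the factor [2 ^+ n], hence the tolerance [eps / 2 ^+ n] asked of the cell. *)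
Lemma good_cube G g (eps : R) : open G -> loc_integrable G g -> 0 < eps ->
  (0 < mu (G `&` [set x | g x != 0%R]))%E ->
  exists (m : 'rV[R]_n) (t a : R), [/\ 0 < t, a != 0, cube m t `<=` G &
    \int[mu]_(y in cube m t) `|g y - a| <= eps * `|a| * (2 * t) ^+ n].
Proof.
move=> oG lg eps0 N0; have e0 : 0 < eps / 2 ^+ n by rewrite divr_gt0 ?exprn_gt0.
have [k [x [a [aN0 xG ix Hx]]]] := good_cell oG lg e0 N0.
have p2 : 0 < 2 ^+ k :> R by rewrite exprn_gt0.
pose m : 'rV[R]_n := \row_i (((grid k x i)%:~R + 2^-1) / 2 ^+ k).
pose t : R := 2 ^- k / 4.
have t0 : 0 < t by rewrite divr_gt0// invr_gt0.
have mt : cube m t `<=` cell k x.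
  move=> y /cubeP ym; apply/ffunP => i; rewrite [LHS]ffunE; apply: floor_def.
  have := ym i; rewrite mxE -(ler_pM2l p2) -[X in X * _]gtr0_norm// -normrM mulrBr.
  rewrite /t mulrCA mulfV ?gt_eqF// mulrA mulfV ?gt_eqF// mul1r.
  by rewrite mulr1 intrD ler_norml => /andP[h1 h2]; apply/andP; split; lra.
have mc := measurable_cell k x; have mC := measurable_cube m t.
exists m, t, a; split => //; first exact: subset_trans xG.
have iga : mu.-integrable (cell k x) (EFin \o (fun y => g y - a)).
  apply: integrable_subr_cst => //.
  by apply: (@le_lt_trans _ _ ((2 ^- k) ^+ n)%:E);
    rewrite ?ltry// -(lebesgue_cell k x).
rewrite -lee_fin /Rintegral fineK; last first.
  apply: (integrable_fin_num mC (f := EFin \o (Num.norm \o (fun y => g y - a)))).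
  by apply: integrable_norm; exact: integrableS iga.
apply: (@le_trans _ _ (\int[mu]_(y in cell k x) `|(g y - a)%:E|)%E).
  apply: ge0_subset_integral => //.
  apply/measurable_EFinP; apply: measurableT_comp => //.
  by apply/measurable_EFinP; case/integrableP: iga.
apply: (le_trans Hx); rewrite lebesgue_cell -EFinM lee_fin /t.
rewrite (_ : 2 * (2 ^- k / 4) = 2 ^- k / 2) ?exprMn ?exprVn; last by lra.
by rewrite le_eqVlt; apply/orP; left; apply/eqP; ring.
Qed.

End good_cube.

(** * Geometry of the elements *)

Section mesh_geometry.
Context {R : realType} {n : nat}.
Implicit Types (c x y z : 'rV[R]_n) (K : set 'rV[R]_n) (sigma b rho : R).

Lemma enorm_ge z i : `|z ord0 i| <= enorm z.
Proof.
rewrite /enorm -sqrtr_sqr ler_wsqrtr// /dotv (bigD1 i)//= expr2 lerDl.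
by apply: sumr_ge0 => j _; rewrite -expr2 sqr_ge0.
Qed.

Lemma enorm_le z b : 0 <= b -> (forall i, `|z ord0 i| <= b) -> enorm z <= n%:R * b.
Proof.
move=> b0 zb; rewrite /enorm -[leRHS]ger0_norm ?mulr_ge0// -sqrtr_sqr ler_wsqrtr//.
apply: (@le_trans _ _ (\sum_(i < n) b ^+ 2)).
  apply: ler_sum => i _; rewrite -expr2 -real_normK ?num_real//.
  by rewrite lerXn2r ?nnegrE.
rewrite sumr_const card_ord -[leLHS]mulr_natl exprMn ler_wpM2r ?sqr_ge0//.
by rewrite -natrX ler_nat; case: (n) => // k; rewrite expnS expn1 leq_pmulr.
Qed.

Lemma polytope_bounded K : polytope K ->
  exists2 b, 0 <= b & forall x, K x -> forall i, `|x ord0 i| <= b.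
Proof.
move=> [N [v ->]]; exists (\sum_(j < N) \sum_(i < n) `|v j ord0 i|).
  by apply: sumr_ge0 => j _; exact: sumr_ge0.
move=> _ [a [a0 a1 ->]] i; rewrite summxE (le_trans (ler_norm_sum _ _ _))//.
apply: ler_sum => j _; rewrite mxE normrM ger0_norm//.
have aj : a j <= 1 by rewrite -a1 (bigD1 j)//= lerDl sumr_ge0.
apply: (@le_trans _ _ `|v j ord0 i|); first by rewrite ler_piMl.
by rewrite (bigD1 i)//= lerDl sumr_ge0.
Qed.

Lemma diam_ge K x y : polytope K -> K x -> K y -> enorm (x - y) <= diam K.
Proof.
move=> /polytope_bounded[b b0 Kb] Kx Ky; apply: ub_le_sup; last first.
  by exists x => //; exists y.
exists (n%:R * (b + b)) => _ [x' Kx' [y' Ky' <-]].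
apply: enorm_le => [|i]; first exact: addr_ge0.
by rewrite !mxE (le_trans (ler_normB _ _))// lerD// Kb.
Qed.

Lemma sub_cube_diam K x : polytope K -> K x -> K `<=` cube x (diam K).
Proof.
move=> pK Kx y Ky; apply/cubeP => i; apply: le_trans (diam_ge pK Ky Kx).
by have := enorm_ge (y - x) i; rewrite !mxE.
Qed.

Definition eball x rho : set 'rV[R]_n := [set y | enorm (y - x) <= rho].

Lemma eball_center x rho : 0 <= rho -> eball x rho x.
Proof.
move=> rho0; rewrite /eball/= subrr (le_trans (@enorm_le 0 0 _ _))// ?mulr0//.
by move=> i; rewrite mxE normr0.
Qed.

(** Compares the centre with a point at distance [rho] along a coordinate axis. It bounds the set
    whose supremum is [inball_diam], so that this supremum is not a default value. *)
Lemma eball_radius_le_diam K x rho : (0 < n)%N -> polytope K -> 0 <= rho ->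
  eball x rho `<=` K -> rho <= diam K.
Proof.
move=> n0 pK rho0 sK; pose i0 := Ordinal n0.
pose y : 'rV[R]_n := x + rho *: delta_mx 0 i0.
have yx i : (y - x) ord0 i = rho * (i == i0)%:R.
  by rewrite !mxE eqxx /= addrAC subrr add0r.
have Ky : K y.
  apply: sK; rewrite /eball/= /enorm.
  rewrite -[leRHS]ger0_norm// -sqrtr_sqr ler_wsqrtr// /dotv (bigD1 i0)//=.
  rewrite big1 ?addr0; first by rewrite yx eqxx mulr1 expr2.
  by move=> i /negbTE ii; rewrite yx ii mulr0 mul0r.
have := enorm_ge (y - x) i0; rewrite yx eqxx mulr1 ger0_norm// => /le_trans; apply.
by apply: diam_ge => //; apply: sK; exact: eball_center.
Qed.

Lemma interior_cube K x : K° x -> exists2 e : R, 0 < e & cube x e `<=` K.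
Proof.
move=> /nbhs_ballP[e /= e0 eK]; exists (e / 2); first by rewrite divr_gt0.
move=> y xy; apply: eK; rewrite -ball_normE/=.
have := mx_norm_le_cube (_ : 0 < e / 2) xy; rewrite divr_gt0// => /(_ erefl); lra.
Qed.

Lemma cube_sub_interior K x rho : 0 < rho -> cube x (rho + rho) `<=` K ->
  cube x rho `<=` K°.
Proof.
move=> rho0 sK y /cubeP xy; apply/nbhs_ballP; exists rho => //= z [_ yz].
apply: sK; apply/cubeP => i; have := yz ord0 i.
rewrite /ball/= /ball_ => /ltW h.
by rewrite -(subrKA (y ord0 i)) (le_trans (ler_normD _ _))// lerD// distrC.
Qed.

Lemma cube_sub_eball x rho b : 0 <= b -> n%:R * b <= rho -> cube x b `<=` eball x rho.
Proof.
move=> b0 nb y /cubeP xy; rewrite /eball/=; apply: le_trans nb.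
by apply: enorm_le => // i; rewrite !mxE.
Qed.

(** Some inscribed ball has radius [rho > diam K / (2 sigma)]. With [b] the half-side in the
    statement, [n * (2 b)] equals that bound, so the cube of half-side [2 b] lies in the ball;
    halving it brings it into the interior. *)
Lemma shape_regular_cube K sigma : (0 < n)%N -> polytope K -> K° !=set0 ->
  0 < sigma -> diam K / inball_diam K < sigma ->
  0 < diam K /\ exists c, cube c ((4 * sigma * n%:R)^-1 * diam K) `<=` K°.
Proof.
move=> n0 pK [x0 Kx0] sigma0 reg.
have nR : 0 < n%:R :> R by rewrite ltr0n.
pose S := [set 2 * rho | rho in
  [set rho : R | 0 <= rho /\ exists x, eball x rho `<=` K]].
have [e e0 eK] := interior_cube Kx0.
have Se : S (2 * e).
  exists e => //; split; first exact: ltW.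
  exists x0 => y; rewrite /eball/= => yx; apply: eK; apply/cubeP => i.
  by have := enorm_ge (y - x0) i; rewrite !mxE => /le_trans; exact.
have ubS : has_sup S.
  split; first by exists (2 * e).
  exists (2 * diam K) => _ [rho [rho0 [x xK]] <-].
  by rewrite ler_pM2l//; exact: eball_radius_le_diam xK.
(* Needed to read the regularity hypothesis, a quotient by 0 being 0 by convention. *)
have inb0 : 0 < inball_diam K.
  have : 2 * e <= sup S by apply: ub_le_sup => //; case: ubS.
  by apply: lt_le_trans; rewrite mulr_gt0.
have d0 : 0 < diam K.
  apply: (lt_le_trans e0); apply: (@eball_radius_le_diam _ x0 _ n0 pK (ltW e0)).
  move=> y; rewrite /eball/= => yx; apply: eK; apply/cubeP => i.
  by have := enorm_ge (y - x0) i; rewrite !mxE => /le_trans; exact.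
split => //.
have lt : diam K / sigma < sup S.
  by move: reg; rewrite !ltr_pdivrMr// mulrC.
have [_ [rho [rho0 [c cK]] <-] Hrho] : exists2 s, S s & diam K / sigma < s.
  have := @sup_adherent _ S (sup S - diam K / sigma); rewrite subr_gt0 => /(_ lt ubS).
  by rewrite subKr.
exists c; set b := _ * diam K.
have b0 : 0 < b by rewrite mulr_gt0// invr_gt0 !mulr_gt0.
apply: cube_sub_interior => //; apply: subset_trans cK.
apply: cube_sub_eball; first by rewrite addr_ge0 ?ltW.
have -> : n%:R * (b + b) = (diam K / sigma) / 2.
  by rewrite /b; field; rewrite !gt_eqF.
by move: Hrho; move: (diam K / sigma) => q; lra.
Qed.

End mesh_geometry.

(** * Summation over the elements *)

Section finite_families.
Context d {T : measurableType d} {R : realType} (nu : {measure set T -> \bar R}).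

Lemma sum_integral_disjoint N (P : pred 'I_N) (C : 'I_N -> set T) (B : set T)
    (f : T -> R) :
  measurable B -> (forall k, P k -> measurable (C k)) ->
  (forall k, P k -> C k `<=` B) ->
  (forall k l, P k -> P l -> k != l -> C k `&` C l = set0) ->
  nu.-integrable B (EFin \o f) -> (forall x, 0 <= f x) ->
  \sum_(k | P k) \int[nu]_(x in C k) f x <= \int[nu]_(x in B) f x.
Proof.
move=> mB mC CB dC iB f0.
pose D k := if P k then C k else set0.
have mD k : measurable (D k) by rewrite /D; case: ifPn => // Pk; exact: mC.
have iD k : nu.-integrable B (EFin \o (f \_ (D k))).
  rewrite -restrict_EFin; apply/integrable_restrict => //.
  by apply: integrableS iB => //; exact: measurableI.
have -> : \sum_(k | P k) \int[nu]_(x in C k) f x = \sum_k \int[nu]_(x in B) (f \_ (D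
  k)) x.
  rewrite big_mkcond; apply: eq_bigr => k _; rewrite -Rintegral_mkcondr /D.
  case: ifPn => Pk; first by rewrite setIidr//; exact: CB.
  by rewrite setI0 Rintegral_set0.
rewrite -Rintegral_fsum//; apply: le_Rintegral => //.
  rewrite (_ : EFin \o _ = (fun x => \sum_k ((f \_ (D k)) x)%:E)%E).
    by apply: integrable_sum => // k _; exact: iD.
  by apply/funext => x; rewrite /= sumEFin.
move=> x Bx; have [[k0 Dk0]|nD] := pselect (exists k, D k x); last first.
  by rewrite big1// => k _; rewrite patchE memNset// => Dk; apply: nD; exists k.
rewrite (bigD1 k0)//= big1 ?addr0; first by rewrite patchE mem_set.
move=> k kk0; rewrite patchE memNset// => Dk; move: Dk Dk0.
rewrite /D; case: ifPn => // Pk Ck; case: ifPn => // Pk0 Ck0.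
by have : (C k `&` C k0) x by []; rewrite dC.
Qed.

Lemma measure_le_sum_cover N (P : pred 'I_N) (C : 'I_N -> set T) (B : set T) :
  measurable B -> (forall k, P k -> measurable (C k)) ->
  (forall x, B x -> exists2 k, P k & C k x) ->
  (nu B <= \sum_(k | P k) nu (C k))%E.
Proof.
move=> mB mC BC.
have [mU leU] : measurable (\big[setU/set0]_(k | P k) C k) /\
    (nu (\big[setU/set0]_(k | P k) C k) <= \sum_(k | P k) nu (C k))%E.
  elim/big_rec2: _ => [|k y A Pk [mA leA]]; first by rewrite measure0.
  have mk := mC _ Pk; split; first exact: measurableU.
  by apply: le_trans (measureU2 _ mk mA) _; rewrite leeD2l.
apply: le_trans leU; apply: le_measure; rewrite ?inE//.
by move=> x /BC[k Pk Ckx]; rewrite (bigD1 k)//=; left.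
Qed.

End finite_families.

(** * Averages against bumps on the elements of a mesh *)

Section averages.
Context {R : realType} {n : nat}.
Implicit Types (c m : 'rV[R]_n) (g : 'rV[R]_n -> R) (G Omega : set 'rV[R]_n).
Local Notation mu := (lebesgue_rV R n).

Definition bump_average g c rho : R :=
  \int[mu]_(x in cube c rho) (g x * bump c rho (fun=> 0%N) x).

Lemma Rintegral_cube_cst c rho (a : R) : 0 <= rho ->
  \int[mu]_(x in cube c rho) cst a x = a * (2 * rho) ^+ n.
Proof.
move=> rho0; rewrite Rintegral_cst; last exact: measurable_cube.
by congr (_ * _); exact: (congr1 fine (lebesgue_cube c rho0)).
Qed.

(** Write [g = a + (g - a)]. The constant contributes at least [|a| b rho^n], because the bump is at
    least [b] on the half-size cube, of volume [rho^n]; the rest is bounded by the maximum [M] of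
    the bump. *)
Lemma bump_average_ge : exists b M : R, [/\ 0 < b, 0 < M & forall g c rho a,
  0 < rho -> mu.-integrable (cube c rho) (EFin \o g) ->
  `|a| * (b * rho ^+ n) - M * \int[mu]_(x in cube c rho) `|g x - a| <=
  `|bump_average g c rho|].
Proof.
have [b b0 Hb] := @bump_lbound R n; have [M M1 HM] := @bump_bounded R n 0%N.
have M0 : 0 < M := lt_le_trans ltr01 M1.
exists b, M; split => // g c rho a rho0 ig.
pose phi := bump c rho (fun=> 0%N).
have mC := measurable_cube c rho.
have Coo := lebesgue_cube_lty c rho.
have iphi : mu.-integrable (cube c rho) (EFin \o phi).
  by apply: integrable_tensor_cube => _ i; exact: smooth1_bump_factor.
have iga : mu.-integrable (cube c rho) (EFin \o (fun x => g x - a)).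
  exact: integrable_subr_cst.
have igap := integrable_mul_bump (fun=> 0%N) rho0 iga.
have iap : mu.-integrable (cube c rho) (EFin \o (fun x => a * phi x)).
  by have := integrableZl mC a iphi; apply: eq_integrable => // x _; rewrite /= EFinM.
have -> : bump_average g c rho = a * \int[mu]_(x in cube c rho) phi x +
    \int[mu]_(x in cube c rho) ((g x - a) * phi x).
  rewrite -RintegralZl// -RintegralD//; apply: eq_Rintegral => x _.
  by rewrite mulrBl addrC subrK.
have phi_ge : b * rho ^+ n <= \int[mu]_(x in cube c rho) phi x.
  have sC : cube c (rho / 2) `<=` cube c rho.
    by move=> x /cubeP H; apply/cubeP => i; apply: (le_trans (H i)); lra.
  have mC2 := measurable_cube c (rho / 2).
  apply: (@le_trans _ _ (\int[mu]_(x in cube c (rho / 2)) phi x)).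
    apply: (@le_trans _ _ (\int[mu]_(x in cube c (rho / 2)) cst b x)).
      rewrite Rintegral_cube_cst; last by lra.
      by rewrite (_ : 2 * (rho / 2) = rho) //; lra.
    apply: le_Rintegral => //.
    - apply: measurable_bounded_integrable => //; first exact: lebesgue_cube_lty.
      exact: bounded_cst.
    - exact: integrableS iphi.
    - by move=> x; exact: Hb.
  rewrite /Rintegral fine_le//.
  - by apply: integrable_fin_num => //; exact: integrableS iphi.
  - exact: integrable_fin_num.
  - apply: ge0_subset_integral => //; first by case/integrableP: iphi.
    by move=> x _; rewrite lee_fin bump_ge0.
have rest_le : `|\int[mu]_(x in cube c rho) ((g x - a) * phi x)| <=
    M * \int[mu]_(x in cube c rho) `|g x - a|.
  apply: le_trans (le_normr_Rintegral mC igap) _.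
  rewrite -RintegralZl//; last exact: (integrable_norm iga).
  apply: le_Rintegral => //; first exact: (integrable_norm igap).
    have := integrableZl mC M (integrable_norm iga).
    by apply: eq_integrable => // x _; rewrite /= EFinM.
  move=> x _; rewrite normrM mulrC ler_wpM2r//.
  have := HM c rho (fun=> 0%N) x rho0 (fun=> leqnn 0).
  by rewrite /mlen big1// expr0 invr1 mulr1.
apply: le_trans (lerB_normD _ _); apply: lerB => //.
rewrite normrM ler_wpM2l//; apply: (le_trans phi_ge); exact: ler_norm.
Qed.

Lemma averages_lower_bound G Omega g (kappa : R) : 0 < kappa ->
  open G -> G `<=` Omega -> loc_integrable G g ->
  (0 < mu (G `&` [set x | g x != 0%R]))%E ->
  exists c1 c2 h0 : R, [/\ 0 < c1, 0 < c2, 0 < h0 &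
    forall (T : mesh R n) (z : 'I_(nelt T) -> 'rV[R]_n), partition_of Omega T ->
      (forall k, 0 < diam (elt T k) /\
        cube (z k) (kappa * diam (elt T k)) `<=` (elt T k)°) ->
      mesh_size T < h0 ->
      exists P : pred 'I_(nelt T), [/\ forall k, P k -> elt T k `<=` G,
        c1 <= \sum_(k | P k) `|bump_average g (z k) (kappa * diam (elt T k))| &
        \sum_(k | P k) diam (elt T k) ^+ n <= c2]].
Proof.
move=> kappa0 oG GO lg N0.
have [b [M [b0 M0 HI]]] := bump_average_ge.
(* [D] converts [(2 h)^n], the volume of a cube covering an element, into the bump contribution
   [b (kappa h)^n]; [eps] makes the loss [M * (eps * |a| * (2 t)^n)] half of the gain
   [|a| * D * t^n]. *)
pose D : R := b * kappa ^+ n / 2 ^+ n.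
have D0 : 0 < D by rewrite divr_gt0 ?mulr_gt0 ?exprn_gt0.
pose eps := D / (2 * (M * 2 ^+ n)).
have eps_gt0 : 0 < eps by rewrite divr_gt0 ?mulr_gt0 ?exprn_gt0.
have [m [t [a [t0 aN0 mG Hg]]]] := good_cube oG lg eps_gt0 N0.
have an0 : 0 < `|a| by rewrite normr_gt0.
exists (`|a| * t ^+ n * D / 2), ((t / kappa) ^+ n), (t / 2); split.
- by rewrite !divr_gt0 ?mulr_gt0 ?exprn_gt0.
- by rewrite exprn_gt0 ?divr_gt0.
- by rewrite divr_gt0.
move=> T z [Tp Tcov Tdisj _] Hz hT.
pose h k := diam (elt T k).
have hk k : h k < t / 2.
  by apply: le_lt_trans hT; apply: le_bigmax.
have h0 k : 0 < h k by have [] := Hz k.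
pose C k := cube (z k) (kappa * h k).
have CK k : C k `<=` (elt T k)° by have [] := Hz k.
have mC k : measurable (C k) by exact: measurable_cube.
exists (fun k => `[< elt T k `<=` cube m t >]).
have PG k : `[< elt T k `<=` cube m t >] -> elt T k `<=` G.
  by move=> /asboolP kt; exact: subset_trans mG.
have PC k : `[< elt T k `<=` cube m t >] -> C k `<=` cube m t.
  by move=> /asboolP kt; apply: subset_trans kt; apply: subset_trans (CK k) _;
    exact: interior_subset.
have disj k l : k != l -> C k `&` C l = set0.
  by move=> kl; apply/seteqP; split => // x [/CK Kx /CK Lx]; rewrite -(Tdisj _ _ kl).
have mt := measurable_cube m t.
have igt : mu.-integrable (cube m t) (EFin \o g).
  by case: lg => _; apply => //; exact: compact_cube.
have too := lebesgue_cube_lty m t.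
have ict : mu.-integrable (cube m t) (EFin \o cst 1).
  by apply: measurable_bounded_integrable => //; exact: bounded_cst.
have iga : mu.-integrable (cube m t) (EFin \o (fun x => g x - a)).
  exact: integrable_subr_cst.
(* Packing: the disjoint cubes of side [2 kappa h] lie in a cube of side [2 t]. *)
have S2 : \sum_(k | `[< elt T k `<=` cube m t >]) h k ^+ n <= (t / kappa) ^+ n.
  have := @sum_integral_disjoint _ _ _ mu _ (fun k => `[< elt T k `<=` cube m t >])
    C (cube m t) (cst 1) mt (fun k _ => mC k) PC (fun k l _ _ => @disj k l) ict
    (fun=> ler01).
  rewrite (Rintegral_cube_cst _ _ (ltW t0)) mul1r.
  rewrite (eq_bigr (fun k => (2 * kappa) ^+ n * h k ^+ n)); last first.
    have kh0 k : 0 <= kappa * h k by rewrite mulr_ge0 ?ltW.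
    move=> k _; rewrite (Rintegral_cube_cst _ _ (kh0 k)) mul1r.
    by rewrite mulrA exprMn.
  rewrite -mulr_sumr mulrC -ler_pdivlMr ?exprn_gt0 ?mulr_gt0//.
  move=> /le_trans; apply; rewrite -expr_div_n le_eqVlt; apply/orP; left; apply/eqP.
  by congr (_ ^+ n); field; rewrite gt_eqF.
(* Covering: an element that meets the cube of half-side [t / 2] and has diameter below [t / 2]
   stays inside [cube m t], and it is contained in the cube of half-side [h k] about [z k]. *)
have S0 : t ^+ n <= \sum_(k | `[< elt T k `<=` cube m t >]) (2 * h k) ^+ n.
  have cov x : cube m (t / 2) x ->
      exists2 k, `[< elt T k `<=` cube m t >] & cube (z k) (h k) x.
    move=> xm; have : closure Omega x.
      apply: subset_closure; apply: GO; apply: mG.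
      by move: xm => /cubeP H; apply/cubeP => i; apply: (le_trans (H i)); lra.
    rewrite Tcov => -[k _ kx]; exists k.
      apply/asboolP => y ky; apply/cubeP => i.
      have /cubeP/(_ i) yx := sub_cube_diam (Tp k).1 kx ky.
      have /cubeP/(_ i) := xm; move: yx (hk k); rewrite -/(h k) => yx hkk xm'.
      rewrite -(subrKA (x ord0 i)) (le_trans (ler_normD _ _))//; lra.
    have zk : elt T k (z k).
      apply: interior_subset; apply: CK; apply/cubeP => i.
      by rewrite subrr normr0 mulr_ge0 ?ltW.
    exact: (sub_cube_diam (Tp k).1 zk kx).
  have := @measure_le_sum_cover _ _ _ mu _ (fun k => `[< elt T k `<=` cube m t >])
    (fun k => cube (z k) (h k)) (cube m (t / 2)) (measurable_cube _ _)
    (fun k _ => measurable_cube _ _) cov.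
  have t20 : 0 <= t / 2 by lra.
  have -> : (\sum_(k | `[< elt T k `<=` cube m t >]) mu (cube (z k) (h k)) =
      (\sum_(k | `[< elt T k `<=` cube m t >]) (2 * h k) ^+ n)%:E)%E.
    by rewrite -sumEFin; apply: eq_bigr => k _; rewrite lebesgue_cube// ltW.
  move=> le_cover; rewrite -lee_fin; apply: le_trans le_cover.
  rewrite (_ : t ^+ n = (2 * (t / 2)) ^+ n); last by congr (_ ^+ _); lra.
  by rewrite -(lebesgue_cube m t20).
have S3 : \sum_(k | `[< elt T k `<=` cube m t >]) \int[mu]_(x in C k) `|g x - a| <=
    eps * `|a| * (2 * t) ^+ n.
  apply: le_trans Hg; apply: sum_integral_disjoint => //.
    by move=> k l _ _; exact: disj.
  exact: (integrable_norm iga).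
split => //.
apply: (@le_trans _ _ (\sum_(k | `[< elt T k `<=` cube m t >])
    (`|a| * (b * (kappa * h k) ^+ n) - M * \int[mu]_(x in C k) `|g x - a|)));
      last first.
  apply: ler_sum => k Pk; apply: HI; first by rewrite mulr_gt0.
  by apply: integrableS igt => //; [exact: mC|exact: (PC k Pk)].
rewrite sumrB -[X in _ - X]mulr_sumr.
have -> : \sum_(k | `[< elt T k `<=` cube m t >]) `|a| * (b * (kappa * h k) ^+ n) =
    `|a| * D * \sum_(k | `[< elt T k `<=` cube m t >]) (2 * h k) ^+ n.
  rewrite mulr_sumr; apply: eq_bigr => k _; rewrite /D !exprMn; field.
  by rewrite expf_neq0.
apply: (@le_trans _ _ (`|a| * D * t ^+ n - M * (eps * `|a| * (2 * t) ^+ n))).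
  rewrite /eps exprMn le_eqVlt; apply/orP; left; apply/eqP; field.
  by rewrite expf_neq0// gt_eqF.
by apply: lerB; apply: ler_wpM2l => //; [rewrite mulr_ge0// ltW|exact: ltW].
Qed.

End averages.

(** * The lower bounds of the discretization error *)

(** Plays the part of Hoelder's inequality for sums: being affine in [x], the minorant can be summed
    over the elements. It is nonpositive for [x <= tau]; beyond [tau], [x^(p-1) >= tau^(p-1)]. *)
Lemma powR_ge_affine (R : realType) (x tau p : R) : 0 <= x -> 0 < tau -> 1 <= p ->
  tau `^ (p - 1) * (x - tau) <= x `^ p.
Proof.
move=> x0 tau0 p1; have [xt|tx] := leP x tau.
  by apply: le_trans (powR_ge0 _ _); rewrite mulr_ge0_le0 ?powR_ge0// subr_le0.
have xp : 0 < x := lt_trans tau0 tx.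
have -> : x `^ p = x `^ (p - 1) * x.
  by rewrite -[X in _ = _ * X](powRr1 x0) -powRD ?subrK// (gt_eqF xp) implybT.
apply: ler_pM; rewrite ?powR_ge0 ?subr_ge0 ?(ltW tx)//; last by rewrite gerBl ltW.
by apply: ge0_ler_powR; rewrite ?nnegrE ?subr_ge0// ltW.
Qed.

Lemma frac_norm_weak_deriv (R : realType) n (s p : R) (G : set 'rV[R]_n) w gamma :
  0 < p -> 0 <= s -> ((mlen gamma)%:R <= s) -> (frac_norm s p G w < +oo)%E ->
  is_weak_deriv G gamma w (wderiv G gamma w).
Proof.
move=> p0 s0 gs; rewrite /frac_norm /sobolev_norm.
case: ifPn => [/asboolP /(_ gamma) H _|_].
  have [g Hg] : exists g, is_weak_deriv G gamma w g.
    by apply: H; rewrite truncn_ge_nat.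
  exact: (xgetPex (cst 0) (ex_intro _ g Hg)).
have pN0 : p != 0 by rewrite gt_eqF.
rewrite (poweRyr pN0) addye ?poweRyr ?invr_neq0 ?ltxx//.
(* The infinite Sobolev part could only be absorbed by a fractional part equal to [-oo], which its
   nonnegativity excludes. *)
case: ifPn => // _; rewrite -ltNye; apply: (@lt_le_trans _ _ 0%E) => //.
apply: sume_ge0 => al _; apply: integral_ge0 => x _; apply: integral_ge0 => y _.
by rewrite lee_fin divr_ge0 ?powR_ge0.
Qed.

Theorem corollary4p2 (R : realType) (n m r : nat) (Omega G : set 'rV[R]_n)
  (f u : 'rV[R]_n -> R)
  (I : Type) (T : I -> mesh R n) (V : forall i : I, set (pw_fun (T i)))
  (uh : forall i : I, pw_fun (T i))
  (s p delta : R) (gamma : 'I_n -> nat)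
  (n_ge1 : (1 <= n)%N) (m_ge1 : (1 <= m)%N) (r_ge1 : (1 <= r)%N)
  (Omega_domain : domain Omega) (Omega_bounded : bounded_set Omega)
  (Omega_polytopic : polytopic Omega)
  (Omega_lipschitz : lipschitz_boundary Omega)
  (T_partition : forall i, partition_of Omega (T i))
  (T_regular : regular_family T)
  (V_fe : forall i, fe_space r (V i))
  (f_L2 : L2_fun Omega f)
  (u_H0 : H0 m Omega u)
  (u_sol : forall v, H0 m Omega v -> a_form m Omega u v = L2_dot Omega f v)
  (uh_V : forall i, V i (uh i))
  (uh_sol : forall i vh, V i vh -> ah_form m (uh i) vh = L2_dot_h f vh)
  (s_gt0 : 0 < s) (s_le : s <= r%:R)
  (u_Hs : (frac_norm s 2 Omega u < +oo)%E)
  (upper_bound : exists C : R, 0 < C /\ forall i,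
     (norm_mh m (err u (uh i)) <=
      (C * mesh_size (T i) `^ (s - m%:R))%R%:E * frac_norm s 2 Omega u)%E)
  (p_ge1 : 1 <= p) (delta_gt0 : 0 < delta)
  (G_domain : domain G) (G_contained : compactly_contained G Omega)
  (u_G : (frac_norm (r%:R + delta) p G u < +oo)%E)
  (gamma_len : mlen gamma = r)
  (u_gamma : (0 < Lp_norm G p%:E (wderiv G gamma u))%E)
  (V_gamma : forall i vh, V i vh -> forall k x, elt (T i) k x ->
     pderiv gamma (vh k) x = 0) :
  (forall j : nat, (j <= r)%N ->
     exists C17 h0 : R, [/\ 0 < C17, 0 < h0 & forall i, mesh_size (T i) < h0 ->
       (C17%:E <=
        weighted_norm p (j%:R - r%:R) j p%:E G (err u (uh i)))%E]) /\
  (forall (j : nat) (q : \bar R), (j <= r)%N -> (1 <= q)%E ->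
     embeds (r%:R + delta) p j q G ->
     exists C18 h0 : R, [/\ 0 < C18, 0 < h0 & forall i, mesh_size (T i) < h0 ->
       (C18%:E <=
        weighted_norm p (j%:R - r%:R + n%:R * (p^-1 - fine (q^-1)%E)) j q G
          (err u (uh i)))%E]).
Proof.
have p0 : 0 < p := lt_le_trans ltr01 p_ge1.
have [_ oG _] := G_domain; have [GO _ _] := G_contained.
have ug : is_weak_deriv G gamma u (wderiv G gamma u).
  apply: frac_norm_weak_deriv u_G => //; first by rewrite addr_ge0// ltW.
  by rewrite gamma_len lerDl ltW.
set g := wderiv G gamma u in ug u_gamma.
have [_ lg _] := ug; have [mg _] := lg.
have N0 := Lp_norm_gt0 (open_measurable_rV oG) mg p0 u_gamma.
have [sigma [sigma0 Hsigma]] := T_regular.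
pose kappa := (4 * sigma * n%:R)^-1.
have kappa0 : 0 < kappa by rewrite invr_gt0 !mulr_gt0// ltr0n.
have [c1 [c2 [h0 [c10 c20 h00 Hsum]]]] := averages_lower_bound kappa0 oG GO lg N0.
(* The first bound is the case [q = p] of the second, where the term [n (1/p - 1/q)] vanishes. *)
suff core (j : nat) (q : \bar R) : (j <= r)%N -> (1 <= q)%E ->
    exists C h0 : R, [/\ 0 < C, 0 < h0 & forall i, mesh_size (T i) < h0 ->
      (C%:E <= weighted_norm p (j%:R - r%:R + n%:R * (p^-1 - fine (q^-1)%E)) j q G
        (err u (uh i)))%E].
  split=> [j jr|j q jr q1 _]; last exact: core.
  have := core j p%:E jr; rewrite lee_fin => /(_ p_ge1).
  by rewrite inver (gt_eqF p0)/= subrr mulr0 addr0.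
move=> jr q1; have [A A0 HA] := @local_lower_bound R n r j q p kappa jr q1 p_ge1 kappa0.
(* Chosen so that [tau * c2 = c1 / 2]: the subtracted term of the affine minorant uses up at most
   half of the sum of the averages. *)
pose tau := c1 / (2 * c2).
have tau0 : 0 < tau by rewrite divr_gt0// mulr_gt0.
pose Z := A * (tau `^ (p - 1) * (c1 / 2)).
have Z0 : 0 < Z by rewrite !mulr_gt0 ?powR_gt0// divr_gt0.
exists (Z `^ p^-1), h0; split => //; first exact: powR_gt0.
move=> i hi.
have [Tp _ _ _] := T_partition i.
have geo k : 0 < diam (elt (T i) k) /\
    exists c, cube c (kappa * diam (elt (T i) k)) `<=` (elt (T i) k)°.
  have [pk ik] := Tp k.
  exact: shape_regular_cube n_ge1 pk ik sigma0 (Hsigma i k).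
have [z Hz] := choice (fun k => (geo k).2).
have [P [PG S1 S2]] := Hsum (T i) z (T_partition i) (fun k => conj (geo k).1 (Hz k)) hi.
rewrite /weighted_norm -poweR_EFin.
pose F k := ((diam (elt (T i) k) `^
    (p * (j%:R - r%:R + n%:R * (p^-1 - fine (q^-1)%E))))%R%:E *
  sobolev_norm j q (elt (T i) k)° (err u (uh i) k) `^ p)%E.
have F0 k : (0 <= F k)%E by rewrite mule_ge0 ?poweR_ge0// lee_fin powR_ge0.
have sF0 : (0 <= \sum_(k < nelt (T i) | `[< elt (T i) k `<=` G >]) F k)%E.
  by apply: sume_ge0.
rewrite -/(\sum_(k < nelt (T i) | `[< elt (T i) k `<=` G >]) F k)%E.
apply: gt0_ler_poweR.
- by rewrite invr_ge0 ltW.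
- by rewrite in_itv/= leey andbT lee_fin ltW.
- by rewrite in_itv/= leey andbT.
(* The terms are nonnegative, so the sum over the elements in [G] may be reduced to those selected
   by [P]. *)
apply: (@le_trans _ _ (\sum_(k < nelt (T i) | P k) F k)%E); last first.
  rewrite [leRHS](bigID P)/= -[leLHS]adde0.
  apply: leeD; last by apply: sume_ge0.
  rewrite le_eqVlt; apply/orP; left; apply/eqP; apply: eq_bigl => k.
  by case: (boolP (P k)) => [Pk|]; rewrite ?andbF ?andbT//; apply/esym/asboolP/PG.
pose h k := diam (elt (T i) k).
pose X k := `|bump_average g (z k) (kappa * h k)|.
apply: (@le_trans _ _ (\sum_(k < nelt (T i) | P k)
   (A * (h k ^+ n * (X k / h k ^+ n) `^ p))%:E)%E); last first.
  apply: lee_sum => k Pk.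
  have oK : open (elt (T i) k)° by exact: open_interior.
  apply: (HA (elt (T i) k)° G u g (uh i k) gamma r (z k) (h k) (geo k).1
    (open_measurable_rV oK) (Hz k) _ ug gamma_len).
  - by apply: subset_trans (PG k Pk); exact: interior_subset.
  - by have [H _ _] := V_fe i; exact: H.
  - by move=> x Cx; apply: V_gamma (uh_V i) _ _ _; apply: interior_subset; exact: Hz Cx.
rewrite sumEFin lee_fin -mulr_sumr /Z; apply: ler_wpM2l; first exact: ltW.
(* The affine minorant at [x = X k / h k ^+ n], multiplied by [h k ^+ n]; [S1] bounds the sum of the
   [X k] from below and [S2] that of the [h k ^+ n] from above. *)
apply: (@le_trans _ _ (\sum_(k < nelt (T i) | P k) tau `^ (p - 1) * (X k - tau * h k ^+ n))).
  rewrite -mulr_sumr ler_wpM2l ?powR_ge0// sumrB -mulr_sumr.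
  have t2 := ler_wpM2l (ltW tau0) S2.
  have tc : tau * c2 = c1 / 2 by rewrite /tau; field; rewrite gt_eqF.
  rewrite tc in t2; move: S1 t2; rewrite -/h; move=> S1 t2.
  have -> : c1 / 2 = c1 - c1 / 2 by lra.
  exact: lerB.
apply: ler_sum => k _.
have hk : 0 < h k ^+ n by rewrite exprn_gt0//; exact: (geo k).1.
have Xh : 0 <= X k / h k ^+ n by rewrite divr_ge0 ?normr_ge0// ltW.
have := ler_wpM2l (ltW hk) (powR_ge_affine Xh tau0 p_ge1); apply: le_trans.
rewrite le_eqVlt; apply/orP; left; apply/eqP.
by field; rewrite gt_eqF.
Qed.
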